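(* Let $k\geq 2$ be an even integer and let $\Delta\colon\mathbb{N}\to\mathbb{N}$ be an arbitrary coloring. Then there is an infinite set $X=\{x_1<x_2<\cdots\}\subseteq\mathbb{N}$ such that, writing $X^*_{alt}=X^*_{alt}(k)=\{\sum^*_{j\in J}x_j : J\in\binom{\mathbb{N}}{k}\}$, the sets $X$ and $X^*_{alt}$ are colored according to one of the following patterns: (i) $X\cup X^*_{alt}$ is monochromatic; or (ii) $X\cup X^*_{alt}$ is rainbow; or (iii) $X$ is rainbow and $\Delta(\sum^*_{j\in J}x_j)=\Delta(x_{\max J})$ for all $J\in\binom{\mathbb{N}}{k}$; or (iv) $X$ is monochromatic, $\Delta(X)\cap\Delta(X^*_{alt})=\emptyset$, and for all $I,J\in\binom{\mathbb{N}}{k}$: $\Delta(\sum^*_{j\in J}x_j)=\Delta(\sum^*_{j\in I}x_j)$ if and only if $\min I=\min J$; or (v) $X$ is rainbow, $\Delta(X)\cap\Delta(X^*_{alt})=\emptyset$, and for all $I,J\in\binom{\mathbb{N}}{k}$: $\Delta(\sum^*_{j\in J}x_j)=\Delta(\sum^*_{j\in I}x_j)$ if and only if $\min I=\min J$ and $\max I=\max J$. For $k\geq 4$ none of the five patterns can be omitted without violating the theorem (i.e., for each pattern there is a coloring $\Delta\colon\mathbb{N}\to\mathbb{N}$ such that no infinite $X\subseteq\mathbb{N}$ satisfies any of the other four patterns). For $k=2$ patterns (ii) and (v) coincide, and none of the four patterns (i)–(iv) can be omitted without violating the theorem.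
   Context: $\mathbb{N}$ denotes the set of positive integers; $\binom{Y}{k}$ is the set of $k$-element subsets of $Y$; $\Delta(Y)=\{\Delta(y):y\in Y\}$. Monochromatic means all elements have the same color; rainbow means all elements have pairwise distinct colors. The elements of $X$ are indexed increasingly $x_1<x_2<\cdots$. For even $k$ and $J=\{j_1<j_2<\cdots<j_k\}\subseteq\mathbb{N}$, the alternating sum is $\sum^*_{j\in J}x_j=x_{j_k}-x_{j_{k-1}}+x_{j_{k-2}}-x_{j_{k-3}}+\cdots+x_{j_2}-x_{j_1}$.
   Formalization: For k=2, ''(ii) and (v) coincide'' fails for a fixed X (X=ℕ, Δ injective has (ii), not (v)); instead: (v) holds iff (ii) holds, distinct J give distinct alternating sums and none lies in X; and every X with (ii) contains an infinite Y with (v). *)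

(* Defs.v *)
From HB Require Import structures.
From mathcomp Require Import all_boot all_order all_algebra finmap.
From mathcomp Require Import all_classical.

Set Implicit Arguments.
Unset Strict Implicit.
Unset Printing Implicit Defensive.

Local Open Scope classical_set_scope.

Definition Npos : set nat := [set n | 0 < n].

(* A map from the positive integers to the positive integers; the value at 0
   is junk and is never inspected. *)
Definition coloring (D : nat -> nat) : Prop := forall n, Npos n -> Npos (D n).

(* [x 1 < x 2 < ...] are the elements of [X]; the value [x 0] is junk. *)
Definition enumerates (x : nat -> nat) (X : set nat) : Prop :=
  (forall i j, 0 < i -> i < j -> x i < x j) /\ X = x @` Npos.

Definition infinite_subset (X : set nat) (x : nat -> nat) : Prop :=
  [/\ X `<=` Npos, infinite_set X & enumerates x X].

Definition ksubsets (k : nat) : set {fset nat} :=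
  [set J : {fset nat} | [set` J] `<=` Npos /\ #|` J|%fset = k].

Definition incr_seq (J : {fset nat}) : seq nat := sort leq (enum_fset J).
Definition minJ (J : {fset nat}) : nat := head 0 (incr_seq J).
Definition maxJ (J : {fset nat}) : nat := last 0 (incr_seq J).

(* (x_{j_2} - x_{j_1}) + (x_{j_4} - x_{j_3}) + ... + (x_{j_k} - x_{j_{k-1}}).
   The subtraction of nat truncates, but for increasing x every difference is
   positive; see [alt_sumE]. *)
Definition alt_sum (x : nat -> nat) (J : {fset nat}) : nat :=
  \sum_(i < #|` J|%fset./2)
    (x (nth 0 (incr_seq J) i.*2.+1) - x (nth 0 (incr_seq J) i.*2)).

Definition Xalt (k : nat) (x : nat -> nat) : set nat :=
  [set alt_sum x J | J in ksubsets k].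

Definition monochromatic (D : nat -> nat) (A : set nat) : Prop :=
  forall a b, A a -> A b -> D a = D b.

Definition rainbow (D : nat -> nat) (A : set nat) : Prop :=
  forall a b, A a -> A b -> a <> b -> D a <> D b.

Variant pattern := PatI | PatII | PatIII | PatIV | PatV.

Definition has_pattern (k : nat) (D : nat -> nat) (X : set nat)
    (x : nat -> nat) (p : pattern) : Prop :=
  match p with
  | PatI => monochromatic D (X `|` Xalt k x)
  | PatII => rainbow D (X `|` Xalt k x)
  | PatIII =>
      rainbow D X /\
      (forall J, ksubsets k J -> D (alt_sum x J) = D (x (maxJ J)))
  | PatIV =>
      [/\ monochromatic D X,
          D @` X `&` D @` Xalt k x = set0 &
          forall I J, ksubsets k I -> ksubsets k J ->
            (D (alt_sum x J) = D (alt_sum x I) <-> minJ I = minJ J)]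
  | PatV =>
      [/\ rainbow D X,
          D @` X `&` D @` Xalt k x = set0 &
          forall I J, ksubsets k I -> ksubsets k J ->
            (D (alt_sum x J) = D (alt_sum x I) <->
             minJ I = minJ J /\ maxJ I = maxJ J)]
  end.

(* No numerical coincidences: distinct index sets give distinct alternating
   sums, and none of these sums lies in [X]. *)
Definition alt_generic (k : nat) (X : set nat) (x : nat -> nat) : Prop :=
  (forall I J, ksubsets k I -> ksubsets k J ->
     alt_sum x I = alt_sum x J -> I = J) /\
  X `&` Xalt k x = set0.

Import GRing.Theory.

Lemma alt_sumE (k : nat) (x : nat -> nat) (X : set nat) (J : {fset nat}) :
  ~~ odd k -> enumerates x X -> ksubsets k J ->
  Posz (alt_sum x J) =
    (\sum_(i < k) (-1) ^+ i.+1 * Posz (x (nth 0%N (incr_seq J) i)))%R.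
Proof.
move=> kev [xinc _] [Jpos Jk].
have sJ : size (incr_seq J) = k by rewrite size_sort.
have pos n : n < k -> 0 < nth 0 (incr_seq J) n.
  move=> nk; apply: Jpos => /=.
  by rewrite -(mem_sort leq) mem_nth ?sJ.
have lt n : n.+1 < k -> nth 0 (incr_seq J) n < nth 0 (incr_seq J) n.+1.
  move=> nk.
  have srt : sorted ltn (incr_seq J).
    rewrite ltn_sorted_uniq_leq sort_uniq fset_uniq /=.
    exact: (sort_sorted leq_total).
  by apply: (sorted_ltn_nth ltn_trans) => //; rewrite inE sJ // ltnW.
rewrite /alt_sum Jk.
have kE : k = (k./2).*2 by rewrite even_halfK.
rewrite [in RHS]kE.
have : (k./2).*2 <= k by rewrite -kE.
elim: (k./2) => [|m IH] mk; first by rewrite !big_ord0.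
rewrite big_ord_recr /= doubleS 2!big_ord_recr /= PoszD IH; last first.
  by apply: leq_trans mk; rewrite leq_double.
have -> : ((-1) ^+ m.*2.+1 = -1 :> int)%R.
  by rewrite exprS -signr_odd odd_double mulr1.
have -> : ((-1) ^+ m.*2.+2 = 1 :> int)%R by rewrite -signr_odd /= odd_double.
have lt1 : m.*2.+1 < k by rewrite doubleS in mk.
have h := xinc _ _ (pos _ (ltnW lt1)) (lt _ lt1).
rewrite -addrA mulN1r mul1r; congr (_ + _)%R.
by rewrite addrC subzn // ltnW.
Qed.

(* Main.v *)
Require Import Defs.
From HB Require Import structures.
From mathcomp Require Import all_boot all_order all_algebra finmap.
From mathcomp Require Import all_classical.
From mathcomp Require Import zify.

(** Existence.  An idempotent ultrafilter on the positive integers yields, as in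
    the Milliken-Taylor theorem, a sequence [z] such that for consecutive
    disjoint blocks of indices the truth of [D (sum over A) = D (sum over B)],
    with [A] and [B] unions of at most [2 k] of these blocks, depends only on
    which blocks [A] and [B] use.  Writing [f 13] for the colour of the union of
    a first and a third block, the colour is constant if [f 1 = f 2], determined
    by the maximum if [f 12 = f 2], by the minimum if [f 12 = f 1], by both if
    [f 123 = f 13], and otherwise it is injective.  With
    [x j = z 0 + ... + z (2 j - 1)], so that [x 0 = 0], every alternating sum is
    a sum of [z] over a union of intervals, and [x j] is the alternating sum for
    the index set [{0, j}]; the five cases become the five patterns.

    Necessity.  The five colourings are: constant, identity, binary logarithm,
    2-adic valuation, and the pair of the last two.  Given [X], pass to
    infinitely many elements congruent modulo a large power of 2: this makes the
    valuation of an even alternating sum of them large, and fixes it once a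
    suitable smaller element is prepended.  The logarithm of an alternating
    sum with a huge largest term takes only two values. *)

Set Implicit Arguments.
Unset Strict Implicit.
Unset Printing Implicit Defensive.

Local Open Scope classical_set_scope.

(** * Idempotent ultrafilters *)

Definition shift (A : set nat) (x : nat) : set nat := [set y | A (x + y)].

(** Writing [F * G] for the family of all [A] with [F [set x | G (shift A x)]], the last clause says
    that [F] is contained in [F * F]. This inclusion, unlike equality, visibly survives unions of
    chains, so Zorn's lemma applies. *)
Definition subidempotent (F : set (set nat)) : Prop :=
  [/\ ProperFilter F, F Npos &
      forall A, F A -> F [set x | F (shift A x)]].

Lemma maximal_subidempotent :
  exists F, subidempotent F /\
    forall G, subidempotent G -> F `<=` G -> G = F.
Proof.
(* [Zorn_bigcup] also asks for the union of the empty chain, hence [set0] in [P]. The filter [base]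
   below shows that the maximal element is not [set0]. *)
pose P := [set F : set (set nat) | F = set0 \/ subidempotent F].
have chain (C : set (set (set nat))) : C `<=` P -> total_on C subset ->
    P (\bigcup_(F in C) F).
  move=> CP Ctot; case: (pselect (exists2 F, C F & subidempotent F)); last first.
    move=> none; left; apply/seteqP; split=> // A [F CF FA].
    have [F0|sF] := CP _ CF; first by rewrite F0 in FA.
    by case: none; exists F.
  move=> [F0 CF0 [pF0 F0pos sF0]]; right.
  have sub F A : C F -> F A -> subidempotent F.
    by move=> CF FA; have [F00|//] := CP _ CF; rewrite F00 in FA.
  have join F G A B : C F -> C G -> F A -> G B ->
      exists H, [/\ C H, H A & H B].
    move=> CF CG FA GB; have [FG|GF] := Ctot _ _ CF CG.
      by exists G; split=> //; exact: FG.
    by exists F; split=> //; exact: GF.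
  split.
  - split.
      by move=> [F CF F0']; have [[nF _] _ _] := sub _ _ CF F0'.
    split.
    + by exists F0 => //; exact: filterT.
    + move=> A B [F CF FA] [G CG GB].
      have [H [CH HA HB]] := join _ _ _ _ CF CG FA GB.
      have [pH _ _] := sub _ _ CH HA.
      by exists H => //; exact: filterI.
    + move=> A B AB [F CF FA]; exists F => //.
      by have [pF _ _] := sub _ _ CF FA; exact: filterS FA.
  - by exists F0.
  - move=> A [F CF FA]; have [pF _ sF] := sub _ _ CF FA.
    exists F => //; apply: filterS (sF _ FA) => x Fx.
    by exists F.
have [F [PF Fmax]] := Zorn_bigcup chain.
pose base := [set A : set nat | Npos `<=` A].
have sbase : subidempotent base.
  split => //.
  - split; first by move=> /(_ 1 isT).
    split => //.
    + by move=> A B NA NB x Nx; split; [exact: NA|exact: NB].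
    + by move=> A B AB NA x /NA /AB.
  - move=> A NA x Nx y Ny; apply: NA.
    by rewrite /Npos /= addn_gt0 (_ : 0 < x).
case: PF => [F0|sF].
  case: (Fmax base); last by right.
  rewrite F0 properEneq; split=> //.
  by apply/eqP => /esym e0; have : base setT by []; rewrite e0.
exists F; split=> // G sG FG.
apply: contrapT => GF; case: (Fmax G); last by right.
by rewrite properEneq; split=> //; apply/eqP => FG'; apply: GF.
Qed.

Lemma ultra_setC (p : set (set nat)) A : UltraFilter p -> ~ p A -> p (~` A).
Proof. by move=> up npA; have [] := in_ultra_setVsetC A up. Qed.

(* Papazyan's argument: with [F] maximal and [p] an ultrafilter above [F],
   first [F * p = F], and then [F] absorbs every [[set x | p (shift A x)]]
   with [p A]. *)
Lemma idempotent_ultrafilter :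
  exists p : set (set nat), [/\ UltraFilter p, p Npos &
    forall A, p A -> p [set x | p (shift A x)]].
Proof.
have [F [[pF Fpos sF] Fmax]] := maximal_subidempotent.
have [p [up Fp]] := ultraFilterLemma pF.
pose Q A := [set x | p (shift A x)].
have QI A B : Q A `&` Q B `<=` Q (A `&` B).
  by move=> x [Ax Bx]; apply: filterS2 Ax Bx => y.
have QS A B : A `<=` B -> Q A `<=` Q B.
  by move=> AB x; apply: filterS => y; exact: AB.
(* [F * p] contains [F * F] and so [F]; it is again subidempotent, and maximality gives equality. *)
have Fp_eq : [set A | F (Q A)] = F.
  apply: Fmax; last first.
    by move=> A /sF; apply: filterS => x; exact: Fp.
  split.
  - split.
      move=> F0; have [x] := @filter_ex _ F pF _ F0.
      by rewrite /Q /= => /filter_ex [].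
    split.
    + by rewrite /=; apply: filterS (@filterT _ F _) => x _; exact: filterT.
    + by move=> A B /= FA FB; apply: filterS2 FA FB => x Ax Bx; exact: QI.
    + by move=> A B /QS AB /=; apply: filterS.
  - rewrite /=; apply: filterS (@filterT _ F _) => x _; apply: filterS (Fp _ Fpos) => y.
    by rewrite /shift /Npos /= addn_gt0 => ->; rewrite orbT.
  - move=> A /= /sF; apply: filterS => x /sF /Fp; rewrite /Q.
    apply: filterS => y; apply: filterS => w; rewrite /Q /shift /=.
    by apply: filterS => v /=; rewrite !addnA.
(* The filter generated by [F] and all [Q A] with [p A]; once it equals [F], each such [Q A] lies in
   [F], hence in [p]. *)
pose H := [set C | exists A B, [/\ p A, F B & Q A `&` B `<=` C]].
have sH : subidempotent H.
  split.
  - split.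
      (* If [Q A] and [B] were disjoint, [Q] of the complement of [A] would be in [F]; by [Fp_eq] so
         would the complement itself, contradicting [p A]. *)
      move=> [A [B [pA FB AB]]].
      have : F (Q (~` A)).
        apply: filterS FB => x Bx; apply: (@ultra_setC p (shift A x)) => Ax.
        exact: (AB x).
      rewrite -[F (Q _)]/([set A | F (Q A)] (~` A)) Fp_eq => /Fp nA.
      have p0 : p set0 by rewrite -(setICr A); exact: filterI.
      by case: (@filter_not_empty _ p _ p0).
    split.
    + by exists setT, setT; split=> //; exact: filterT.
    + move=> C C' [A [B [pA FB AB]]] [A' [B' [pA' FB' AB']]].
      exists (A `&` A'), (B `&` B'); split; try exact: filterI.
      move=> x [QAx [Bx B'x]]; split; [apply: AB|apply: AB']; split=> //.
        by apply: QS QAx => y [].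
      by apply: QS QAx => y [].
    + move=> C C' CC' [A [B [pA FB AB]]]; exists A, B; split=> //.
      by apply: subset_trans CC'.
  - by exists setT, Npos; split=> //; exact: filterT.
  - move=> C [A [B [pA FB AB]]]; exists A, [set x | F (shift B x)].
    split=> //; first exact: sF.
    move=> x [QAx Bx]; exists (shift A x), (shift B x); split=> //.
    move=> y [Ay By]; apply: AB; split=> //.
    by apply: filterS Ay => w; rewrite /shift /= addnA.
have HF : H = F.
  by apply: Fmax => // B FB; exists setT, B; split=> //; exact: filterT.
exists p; split=> //; first exact: Fp.
move=> A pA; apply: Fp; rewrite -HF; exists A, setT; split=> //.
exact: filterT.
Qed.

(** * The Milliken-Taylor theorem *)

Definition block_sum (z : nat -> nat) (l : seq nat) : nat := \sum_(i <- l) z i.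

Lemma block_sum_cons z i l : block_sum z (i :: l) = z i + block_sum z l.
Proof. exact: big_cons. Qed.

Lemma block_sum_cat z l1 l2 :
  block_sum z (l1 ++ l2) = block_sum z l1 + block_sum z l2.
Proof. exact: big_cat. Qed.

Definition nonnil (l : seq nat) : bool := 0 < size l.

(** Monotonicity of the concatenation covers both the order inside each block and the order between
    blocks. *)
Definition blocks (ls : seq (seq nat)) : bool :=
  sorted ltn (flatten ls) && all nonnil ls.

Section MillikenTaylor.
Variables (p : set (set nat)) (T : finType) (Phi : T -> seq nat -> Prop).
Variable n : nat.
Hypothesis up : UltraFilter p.
Hypothesis ppos : p Npos.
Hypothesis pidem : forall A, p A -> p [set x | p (shift A x)].

(* Tuples are stored in reverse: the head is the most recent block sum. *)
Fixpoint plim (r : nat) (i : T) (s : seq nat) : Prop :=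
  if r is r'.+1 then p [set y | plim r' i (y :: s)] else Phi i s.

(** The values that may follow [s] without moving any iterated limit away from its value at the
    empty tuple; no constraint once [s] has [n] entries. *)
Definition extension (s : seq nat) : set nat :=
  [set y | size s < n ->
     forall i, plim (n - (size s).+1) i (y :: s) <-> plim n i [::]].

(** The Galvin-Glazer device: from a point of [star A], adding almost any later element leads back
    into [star A]. *)
Definition star (A : set nat) : set nat := A `&` [set x | p (shift A x)].

Lemma star_large A : p A -> p (star A).
Proof. by move=> pA; apply: filterI => //; exact: pidem. Qed.

Lemma shift_star_large A x : star A x -> p (shift (star A) x).
Proof.
move=> [_ /= px]; have := pidem px; apply: filterS2 px => y Axy.
move=> pxy; split=> //; apply: filterS pxy => w.
by rewrite /shift /= addnA.
Qed.

(** Requiring [star] rather than mere membership leaves the newest block sum free to grow by a later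
    element, as in [bump]. *)
Fixpoint good (s : seq nat) : Prop :=
  if s is y :: s' then star (extension s') y /\ good s' else True.

Lemma good_plim s : good s -> size s <= n ->
  forall i, plim (n - size s) i s <-> plim n i [::].
Proof.
case: s => [|y s] /=; first by rewrite subn0.
by move=> [[ext _] _] sn; exact: ext.
Qed.

(** For each [i] the ultrafilter decides which [y] are large, in agreement with the limit at the
    empty tuple; since [T] is finite, these large sets can be intersected. *)
Lemma extension_large s : good s -> p (extension s).
Proof.
move=> gs; have [ns|sn] := leqP n (size s).
  apply: filterS (@filterT _ p _) => y _ /= sn.
  by rewrite ltnNge ns in sn.
have e : n - size s = (n - (size s).+1).+1 by rewrite subnSK.
suff : p [set y | forall i, plim (n - (size s).+1) i (y :: s) <-> plim n i [::]].
  by apply: filterS => y h _.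
apply: filter_forall => i.
have := good_plim gs (ltnW sn) i; rewrite e /= => ext.
have [c|c] := pselect (plim n i [::]).
  by move/ext: (c); apply: filterS => y.
by have := ultra_setC up (fun h => c (ext.1 h)); apply: filterS => y.
Qed.

Definition bump (z : nat) (s : seq nat) : seq nat :=
  if s is y :: s' then y + z :: s' else [::].

(** A new element is left out, opens a block of its own, or joins the newest block. *)
Definition step (L : seq (seq nat)) (z : nat) : seq (seq nat) :=
  L ++ map (cons z) L ++ map (bump z) L.

Definition admissible (L : seq (seq nat)) : set nat :=
  [set z | 0 < z /\ forall s, s \in step L z -> good s].

(** Opening a block succeeds for almost all [z] by [star_large], enlarging one by
    [shift_star_large]; the list [L] is finite. *)
Lemma admissible_large L : (forall s, s \in L -> good s) -> p (admissible L).
Proof.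
move=> gL.
suff : p [set z | forall s, s \in L -> good (z :: s) /\ good (bump z s)].
  apply: filterS2 (ppos) => z z0 gz; split=> // s.
  rewrite !mem_cat => /or3P[/gL//|/mapP[s' /gz[] + _ ->]|/mapP[s' /gz[] _ + ->]//].
  by [].
elim: L gL => [|s L IH] gL.
  by apply: filterS (@filterT _ p _) => z _ s.
have gs : good s by apply: gL; rewrite mem_head.
have {}IH : p [set z | forall s, s \in L -> good (z :: s) /\ good (bump z s)].
  by apply: IH => s' s'L; apply: gL; rewrite inE s'L orbT.
have gz := star_large (extension_large gs).
have gb : p [set z | good (bump z s)].
  case: s {gL gz} gs => [|y s] /=.
    by move=> _; apply: filterS (@filterT _ p _).
  by move=> [/shift_star_large + gs]; apply: filterS => z.
apply: filterS3 gz gb IH => z gz gb IH s'.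
by rewrite inE => /orP[/eqP->//|/IH].
Qed.

Definition next (L : seq (seq nat)) : nat := xget 0 (admissible L).

Fixpoint state (t : nat) : seq (seq nat) :=
  if t is t'.+1 then step (state t') (next (state t')) else [:: [::]].

Lemma nextP L : (forall s, s \in L -> good s) -> admissible L (next L).
Proof.
move=> gL; apply: xgetPex.
by have [z] := @filter_ex _ p _ _ (admissible_large gL); exists z.
Qed.

Lemma state_good t s : s \in state t -> good s.
Proof.
elim: t s => [|t IH] s /=; first by rewrite inE => /eqP->.
by have [_ +] := nextP IH; apply.
Qed.

Let z t := next (state t).

(** As the indices decrease, only the very first can be the newest one. It is absent, alone in its
    block, or followed in its block by another index: the three parts of [step]. *)
Lemma mem_state t ls : sorted gtn (flatten ls) -> all nonnil ls ->
  all (fun i => i < t) (flatten ls) -> map (block_sum z) ls \in state t.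
Proof.
elim: t ls => [|t IH] ls.
  by case: ls => [|[|a l] ls].
case: ls => [|[//|a l] ls] srt ne /= lt.
  by rewrite mem_cat (IH [::]).
move: lt => /andP[]; rewrite ltnS leq_eqVlt => /orP[/eqP at_|at_] lt; last first.
  rewrite mem_cat (IH ((a :: l) :: ls)) //=.
  rewrite at_ /=; move: srt => /= /(order_path_min (rev_trans ltn_trans)).
  by apply: sub_all => b /= /ltn_trans; apply.
have lt' : all (fun i => i < t) (l ++ flatten ls).
  by move: srt => /= /(order_path_min (rev_trans ltn_trans)); rewrite at_.
rewrite mem_cat mem_cat; apply/orP; right; apply/orP.
move: srt => /= /path_sorted srt; move: ne => /= ne.
case: l lt lt' srt => [|b l] lt lt' srt.
  left; apply/mapP; exists (map (block_sum z) ls); first exact: IH.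
  by rewrite block_sum_cons /block_sum big_nil addn0 at_.
right; apply/mapP; exists (map (block_sum z) ((b :: l) :: ls)); first exact: IH.
by rewrite /= block_sum_cons at_ addnC.
Qed.

Lemma state_homogeneous : (forall t, 0 < z t) /\
  forall ls, sorted gtn (flatten ls) -> all nonnil ls -> size ls = n ->
    forall i, Phi i (map (block_sum z) ls) <-> plim n i [::].
Proof.
split=> [t|ls srt ne sn i].
  by have [] := nextP (@state_good t).
have mem : map (block_sum z) ls \in state (\max_(i <- flatten ls) i).+1.
  apply: mem_state => //; apply/allP => j jls.
  by rewrite ltnS; apply: leq_bigmax_seq.
have := good_plim (state_good mem); rewrite size_map sn subnn => /(_ (leqnn n) i).
by [].
Qed.

End MillikenTaylor.

(** Both truth values agree with the same iterated limit along an idempotent ultrafilter. *)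
Theorem Milliken_Taylor (T : finType) (Phi : T -> seq nat -> Prop) (n : nat) :
  exists2 z : nat -> nat, (forall i, 0 < z i) &
    forall i ls ls', blocks ls -> blocks ls' -> size ls = n -> size ls' = n ->
      Phi i (map (block_sum z) ls) -> Phi i (map (block_sum z) ls').
Proof.
have [p [up ppos pidem]] := idempotent_ultrafilter.
(* The construction stores the newest block first, so it is run on reversed tuples. *)
have [zpos zhom] := @state_homogeneous p T (fun i s => Phi i (rev s)) n up ppos pidem.
exists (fun t => next p (fun i s => Phi i (rev s)) n
                  (state p (fun i s => Phi i (rev s)) n t)) => // i ls ls'.
set z := (fun t => _).
have flip ks : blocks ks -> size ks = n ->
    Phi i (map (block_sum z) ks) <-> plim p (fun i s => Phi i (rev s)) n i [::].
  move=> /andP[srt ne] sn; rewrite -(zhom (rev (map rev ks))).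
  - rewrite map_rev revK -map_comp.
    suff -> : [seq (block_sum z \o rev) i | i <- ks] = map (block_sum z) ks by [].
    by apply: eq_map => l; apply: perm_big; rewrite perm_rev.
  - by rewrite -rev_flatten rev_sorted.
  - by rewrite all_rev all_map; apply: sub_all ne => l; rewrite /nonnil /= size_rev.
  - by rewrite size_rev size_map.
by move=> b b' s s' /(flip _ b s) /(flip _ b' s').
Qed.

(** * Canonical colourings of alternating sums *)

Fixpoint asum (x : nat -> nat) (u : seq nat) : nat :=
  if u is a :: b :: u' then x b - x a + asum x u' else 0.

(** Index 0 and lengths below [k] are allowed so that [[:: 0; j]], which represents [x j], is
    covered together with the [k]-element index sets. *)
Definition index_seq (k : nat) (u : seq nat) : Prop :=
  [/\ sorted ltn u, ~~ odd (size u), 0 < size u & size u <= k].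

Variant kind := Constant | ByMin | ByMax | ByMinMax | Injective.

Definition same_key (c : kind) (u v : seq nat) : Prop :=
  match c with
  | Constant => True
  | ByMin => head 0 u = head 0 v
  | ByMax => last 0 u = last 0 v
  | ByMinMax => head 0 u = head 0 v /\ last 0 u = last 0 v
  | Injective => u = v
  end.

Definition canonical_coloring (k : nat) (D x : nat -> nat) (c : kind) : Prop :=
  forall u v, index_seq k u -> index_seq k v ->
    (D (asum x u) = D (asum x v) <-> same_key c u v).

(** The indices of [z] that remain in [asum x u] when [x j] sums the first [2 j] terms of [z].
    Doubling gives every interval at least two indices, so the first and the last index of the union
    differ. *)
Fixpoint spread (u : seq nat) : seq nat :=
  if u is a :: b :: u' then iota a.*2 (b - a).*2 ++ spread u' else [::].

Lemma pair_ind (P : seq nat -> Prop) : P [::] -> (forall a, P [:: a]) ->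
  (forall a b u, P u -> P (a :: b :: u)) -> forall u, P u.
Proof.
move=> P0 P1 P2 u; suff : P u /\ forall a, P (a :: u) by case.
by elim: u => [|b u [IH1 IH2]]; split=> // a; exact: P2.
Qed.

Lemma sorted_iota_cat a m l : (forall i, i \in l -> a + m <= i) ->
  sorted ltn l -> sorted ltn (iota a m ++ l).
Proof.
move=> lb srt; rewrite (sorted_pairwise ltn_trans).
rewrite pairwise_cat -!(sorted_pairwise ltn_trans) srt iota_ltn_sorted !andbT.
apply/allrelP => i j; rewrite mem_iota => /andP[_ im] /lb; exact: leq_trans.
Qed.

Lemma spread_ge u i : sorted ltn u -> i \in spread u -> (head 0 u).*2 <= i.
Proof.
elim/pair_ind: u i => // a b u IH i /= /andP[ab pu].
rewrite mem_cat mem_iota => /orP[/andP[]//|iu].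
have := IH _ (path_sorted pu) iu; apply: leq_trans.
case: u {IH} pu iu => //= c u /andP[bc _] _.
by rewrite leq_double ltnW // (ltn_trans ab).
Qed.

Lemma sorted_spread u : sorted ltn u -> sorted ltn (spread u).
Proof.
elim/pair_ind: u => // a b u IH /= /andP[ab pu].
apply: sorted_iota_cat; last by apply: IH; exact: path_sorted pu.
move=> i iu; have := spread_ge (path_sorted pu) iu; apply: leq_trans.
case: u {IH} pu iu => //= c u /andP[bc _] _; lia.
Qed.

Lemma spread_ends u : sorted ltn u -> ~~ odd (size u) -> 0 < size u ->
  exists l, spread u = (head 0 u).*2 :: rcons l (last 0 u).*2.-1.
Proof.
elim/pair_ind: u => // a b u IH /= /andP[ab pu]; rewrite negbK => ev _.
have [m mE] : exists m, (b - a).*2 = m.+2 by exists ((b - a).*2 - 2); lia.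
case: u pu ev IH => [|c u] pu ev IH.
  have iotaE : iota a.*2.+1 m.+1 = rcons (iota a.*2.+1 m) (a.*2.+1 + m).
    by rewrite -[m.+1]addn1 iotaD cats1.
  exists (iota a.*2.+1 m); rewrite cats0 mE -[LHS]/(_ :: iota _ m.+1) iotaE.
  by congr (_ :: rcons _ _); rewrite /=; lia.
have [l lE] := IH (path_sorted pu) ev isT.
exists (iota a.*2.+1 m.+1 ++ c.*2 :: l); rewrite lE mE /=.
by rewrite rcons_cat.
Qed.

(** * Alternating sums as unions of cells between cut points *)

Section Cuts.
Variable P : pred nat.

(** The closing singleton gives [word] a bit after the last cut, which [word_inj] needs in order to
    recover whether that cut lies in [P]. *)
Fixpoint cells (a : nat) (e : seq nat) : seq (seq nat) :=
  if e is c :: e' then iota a.*2 (c - a).*2 :: cells c e'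
  else [:: [:: a.*2]].

(** A bit tells whether the current cell is selected; it flips exactly at the cuts in [P]. *)
Fixpoint word (b : bool) (e : seq nat) : bitseq :=
  if e is c :: e' then b :: word (b (+) P c) e' else [:: b].

Lemma size_cells a e : size (cells a e) = (size e).+1.
Proof. by elim: e a => //= c e IH a; rewrite IH. Qed.

Lemma size_word b e : size (word b e) = (size e).+1.
Proof. by elim: e b => //= c e IH b; rewrite IH. Qed.

Lemma cells_ge a e i : path ltn a e -> i \in flatten (cells a e) -> a.*2 <= i.
Proof.
elim: e a => [|c e IH] a /=; first by rewrite inE => _ /eqP->.
move=> /andP[ac pe]; rewrite mem_cat mem_iota => /orP[/andP[]//|/(IH _ pe)].
by apply: leq_trans; rewrite leq_double ltnW.
Qed.

Lemma blocks_cells a e : path ltn a e -> blocks (cells a e).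
Proof.
rewrite /blocks; elim: e a => //= c e IH a /andP[ac pe].
have /andP[srt ->] := IH _ pe; rewrite andbT /nonnil size_iota double_gt0.
rewrite subn_gt0 ac andbT; apply: sorted_iota_cat => // i /(cells_ge pe).
by rewrite -doubleD subnKC // ltnW.
Qed.

(** Adjacent selected cells fuse into the intervals of [spread]. The parity condition makes the
    number of end points even, so the last bit is false. *)
Lemma spread_cells a b e : path ltn a e -> b = odd (count P e) ->
  flatten (mask (word b e) (cells a e)) =
  spread (if b then a :: seq.filter P e else seq.filter P e).
Proof.
elim: e a b => [|c e IH] a b; first by move=> _ ->.
move=> /andP[/= ac pe] bE.
have {}IH : flatten (mask (word (b (+) P c) e) (cells c e)) =
    spread (if b (+) P c then c :: seq.filter P e else seq.filter P e).
  by apply: IH => //; rewrite bE oddD oddb addbAC addbb.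
case: b bE IH => /=; case Pc: (P c) => //= bE -> //.
(* In the remaining case the interval begun at [a] runs past the cut [c]; by parity it ends at a
   later cut [d]. *)
have [d [e' fE]] : exists d e', seq.filter P e = d :: e'.
  case: (seq.filter P e) (size_filter P e) => [|d e'] h; last by exists d, e'.
  by rewrite -h in bE.
have cd : c < d.
  have /allP := order_path_min ltn_trans pe; apply.
  have : d \in seq.filter P e by rewrite fE mem_head.
  by rewrite mem_filter => /andP[].
rewrite fE /= catA; congr (_ ++ _).
have -> : (d - a).*2 = (c - a).*2 + (d - c).*2 by lia.
by rewrite iotaD; congr (_ ++ iota _ _); lia.
Qed.

End Cuts.

Lemma word_inj P Q b b' e : word P b e = word Q b' e -> b = b' /\ {in e, P =1 Q}.
Proof.
elim: e b b' => [|c e IH] b b' /=; first by case.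
move=> [<-] /IH[/addbI Pc eq]; split=> // d.
by rewrite inE => /orP[/eqP->//|/eq].
Qed.

Lemma last_difference (A B : bitseq) : size A = size B -> A <> B ->
  exists A0 B0 b R, [/\ A = A0 ++ b :: R, B = B0 ++ ~~ b :: R & size A0 = size B0].
Proof.
elim: A B => [|a A IH] [|b B] //= [sz] ne.
have [AB|/eqP AB] := eqVneq A B.
  subst B; exists [::], [::], a, A; split=> //; congr (_ :: _).
  by case: a b ne => -[].
have [A0 [B0 [c [R [-> -> s0]]]]] := IH _ sz AB.
by exists (a :: A0), (b :: B0), c, R; split=> //=; rewrite s0.
Qed.

(** * Classification of the colourings that are homogeneous on blocks *)

Section Canonical.
Variables (z D : nat -> nat) (n : nat).
Hypothesis n_ge4 : 4 <= n.
Let f (l : seq nat) := D (block_sum z l).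
Hypothesis hom : forall (A B : bitseq) ls ls', size A = size ls ->
  size B = size ls -> size ls' = size ls -> size ls <= n ->
  blocks ls -> blocks ls' -> f (flatten (mask A ls)) = f (flatten (mask B ls)) ->
  f (flatten (mask A ls')) = f (flatten (mask B ls')).

(** Indices 0 and 1 are model blocks: by [hom], each of these three inequalities holds for all pairs
    of consecutive blocks or for none. *)
Let dist12 : Prop := f [:: 0] <> f [:: 1].
Let dist2 : Prop := f [:: 0; 1] <> f [:: 1].
Let dist1 : Prop := f [:: 0; 1] <> f [:: 0].

Lemma hom12 a b : blocks [:: a; b] -> f a = f b -> f [:: 0] = f [:: 1].
Proof.
move=> bl eq; apply: (@hom [:: true; false] [:: false; true] [:: a; b]
  [:: [:: 0]; [:: 1]]) => //=; rewrite ?cats0 //; lia.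
Qed.

Lemma hom2 a b : blocks [:: a; b] -> f (a ++ b) = f b -> f [:: 0; 1] = f [:: 1].
Proof.
move=> bl eq; apply: (@hom [:: true; true] [:: false; true] [:: a; b]
  [:: [:: 0]; [:: 1]]) => //=; rewrite ?cats0 //; lia.
Qed.

Lemma hom1 a b : blocks [:: a; b] -> f (a ++ b) = f a -> f [:: 0; 1] = f [:: 0].
Proof.
move=> bl eq; apply: (@hom [:: true; true] [:: true; false] [:: a; b]
  [:: [:: 0]; [:: 1]]) => //=; rewrite ?cats0 //; lia.
Qed.

(** Equality would transfer to give both [[:: 0; 1; 2]] and [[:: 0; 1]] the colour of [[:: 0; 3]],
    so appending the block [[:: 2]] would not change the colour. *)
Lemma dist_ab_ac a b c : dist1 -> blocks [:: a; b; c] -> f (a ++ b) <> f (a ++ c).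
Proof.
move=> d1 bl eq.
have tr b' c' : blocks [:: [:: 0]; b'; c'] -> f (0 :: b') = f (0 :: c').
  move=> bl'; have := @hom [:: true; true; false] [:: true; false; true]
    [:: a; b; c] [:: [:: 0]; b'; c']; rewrite /= !cats0; apply=> //; lia.
have e1 := tr [:: 1; 2] [:: 3] isT.
have e2 := tr [:: 1] [:: 3] isT.
by apply/d1/(@hom1 [:: 0; 1] [:: 2]) => //=; rewrite e1 e2.
Qed.

(** The mirror image: [[:: 1; 2; 3]] and [[:: 2; 3]] would both have the colour of [[:: 0; 3]]. *)
Lemma dist_ac_bc a b c : dist2 -> blocks [:: a; b; c] -> f (a ++ c) <> f (b ++ c).
Proof.
move=> d2 bl eq.
have tr b' c' : blocks [:: [:: 0]; b'; c'] -> f (0 :: c') = f (b' ++ c').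
  move=> bl'; have := @hom [:: true; false; true] [:: false; true; true]
    [:: a; b; c] [:: [:: 0]; b'; c']; rewrite /= !cats0; apply=> //; lia.
have e1 := tr [:: 1; 2] [:: 3] isT.
have e2 := tr [:: 2] [:: 3] isT.
by apply/d2/(@hom2 [:: 1] [:: 2; 3]) => //=; rewrite -[LHS]e1 e2.
Qed.

Lemma hom_middle a b c d : blocks [:: a; b; c; d] ->
  f (a ++ b ++ d) = f (a ++ c ++ d) -> f [:: 0; 1; 2] = f [:: 0; 2].
Proof.
move=> bl eq.
have tr b' c' d' : blocks [:: [:: 0]; b'; c'; d'] ->
    f (0 :: b' ++ d') = f (0 :: c' ++ d').
  move=> bl'; have := @hom [:: true; true; false; true] [:: true; false; true; true]
    [:: a; b; c; d] [:: [:: 0]; b'; c'; d']; rewrite /= !cats0; apply=> //; lia.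
have e1 := tr [:: 1; 2] [:: 3] [:: 4] isT.
have e2 := tr [:: 2] [:: 3] [:: 4] isT.
have := @hom [:: true; true; true] [:: true; false; true]
  [:: [:: 0]; [:: 1]; [:: 2; 4]] [:: [:: 0]; [:: 1]; [:: 2]].
by rewrite /=; apply=> //; [lia|rewrite [LHS]e1 -e2].
Qed.

Lemma flatten_single (l : seq nat) : flatten [seq [:: i] | i <- l] = l.
Proof. by elim: l => //= a l ->. Qed.

(* The last position where two patterns with equal colours differ can be moved
   freely, which one of [dist_ab_ac], [dist_ac_bc] forbids at either end. *)
Lemma equal_patterns (A0 B0 R : bitseq) ls :
  dist12 -> dist1 -> dist2 -> blocks ls -> size ls <= n ->
  size (A0 ++ true :: R) = size ls -> size A0 = size B0 ->
  f (flatten (mask (A0 ++ true :: R) ls)) =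
  f (flatten (mask (B0 ++ false :: R) ls)) ->
  f [:: 0; 1; 2] = f [:: 0; 2].
Proof.
move=> d12 d1 d2 bl ln szA szB eq.
pose s := size A0; pose r := size R.
(* All blocks become singletons except the one at the differing position, which may be any block [y]
   within the two reserved indices [s] and [s.+1]. The second pattern omits [y], so its colour is
   fixed. *)
pose a := mask A0 (iota 0 s); pose c := mask R (iota s.+2 r).
pose c0 := mask B0 (iota 0 s) ++ c.
pose sing l := [seq [:: i] | i <- l : seq nat].
have mask_sing X l : flatten (mask X (sing l)) = mask X l.
  by rewrite -map_mask flatten_single.
have szs : size ls = (s + r).+1 by rewrite -szA size_cat /= addnS.
have tr y : blocks (sing (iota 0 s) ++ y :: sing (iota s.+2 r)) ->
    f (a ++ y ++ c) = f c0.
  move=> bly; have := @hom _ _ ls (sing (iota 0 s) ++ y :: sing (iota s.+2 r))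
    szA _ _ ln bl bly eq.
  rewrite !mask_cat ?size_map ?size_iota //= !flatten_cat /= !mask_sing.
  by apply; rewrite ?size_cat /= ?size_map ?size_iota -?szB ?szs ?addnS.
have srt1 l : sorted ltn (iota 0 s ++ l ++ iota s.+2 r) ->
    nonnil l -> blocks (sing (iota 0 s) ++ l :: sing (iota s.+2 r)).
  move=> srt ne; rewrite /blocks flatten_cat /= !flatten_single srt /=.
  by rewrite all_cat /= ne !all_map; apply/andP; split; apply/allP.
have srt2 : sorted ltn (iota 0 s ++ s :: s.+1 :: iota s.+2 r).
  by rewrite -[_ :: _ :: _]/(iota s r.+2) -{2}[s]add0n -iotaD iota_ltn_sorted.
have e1 : f (a ++ [:: s] ++ c) = f c0.
  apply: tr; apply: srt1 => //; apply: subseq_sorted srt2; first exact: ltn_trans.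
  rewrite subseq_cat2l.
  by apply: (@cat_subseq _ [:: s] _ [:: s] (s.+1 :: _)) => //; exact: subseq_cons.
have e2 : f (a ++ [:: s.+1] ++ c) = f c0.
  apply: tr; apply: srt1 => //; apply: subseq_sorted srt2; first exact: ltn_trans.
  by rewrite subseq_cat2l; exact: subseq_cons.
have srt : sorted ltn (a ++ [:: s; s.+1] ++ c).
  apply: subseq_sorted srt2; first exact: ltn_trans.
  by apply: cat_subseq; rewrite ?mask_subseq //= !eqxx mask_subseq.
have e := etrans e1 (esym e2).
(* The block moves from [s] to [s.+1] without changing the colour; what this contradicts or implies
   depends on whether something precedes or follows it. *)
case: a c e srt {e1 e2 tr c0} => [|a0 a] [|c0 c] /= e srt.
- by case: d12; apply: (hom12 _ e); rewrite /blocks /= in srt *; lia.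
- case: (@dist_ac_bc [:: s] [:: s.+1] (c0 :: c) d2) => //.
  by rewrite /blocks /= cats0 in srt *; rewrite srt.
- case: (@dist_ab_ac (a0 :: a) [:: s] [:: s.+1] d1) => //.
  by rewrite /blocks /= in srt *; rewrite srt.
- apply: (@hom_middle (a0 :: a) [:: s] [:: s.+1] (c0 :: c)) => //.
  by rewrite /blocks /= cats0 in srt *; rewrite srt.
Qed.

Lemma ext12 a b : f [:: 0] = f [:: 1] -> blocks [:: a; b] -> f a = f b.
Proof.
move=> eq bl; have := @hom [:: true; false] [:: false; true]
  [:: [:: 0]; [:: 1]] [:: a; b]; rewrite /= !cats0; apply=> //; lia.
Qed.

Lemma ext2 a b : f [:: 0; 1] = f [:: 1] -> blocks [:: a; b] -> f (a ++ b) = f b.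
Proof.
move=> eq bl; have := @hom [:: true; true] [:: false; true]
  [:: [:: 0]; [:: 1]] [:: a; b]; rewrite /= !cats0; apply=> //; lia.
Qed.

Lemma ext1 a b : f [:: 0; 1] = f [:: 0] -> blocks [:: a; b] -> f (a ++ b) = f a.
Proof.
move=> eq bl; have := @hom [:: true; true] [:: true; false]
  [:: [:: 0]; [:: 1]] [:: a; b]; rewrite /= !cats0; apply=> //; lia.
Qed.

Lemma ext_middle a b c : f [:: 0; 1; 2] = f [:: 0; 2] -> blocks [:: a; b; c] ->
  f (a ++ b ++ c) = f (a ++ c).
Proof.
move=> eq bl; have := @hom [:: true; true; true] [:: true; false; true]
  [:: [:: 0]; [:: 1]; [:: 2]] [:: a; b; c]; rewrite /= !cats0; apply=> //; lia.
Qed.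

Lemma single_inj i j : dist12 -> f [:: i] = f [:: j] -> i = j.
Proof.
move=> d; wlog ij : i j / i <= j.
  by move=> th; case: (leqP i j) => [|/ltnW] /th h /esym => [/esym|] /h.
rewrite leq_eqVlt in ij; case/orP: ij => [/eqP//|ij] e.
by case: d; apply: hom12 e; rewrite /blocks /= ij.
Qed.

Lemma pair_inj a b a' b' : dist1 -> dist2 -> a < b -> a' < b' ->
  f [:: a; b] = f [:: a'; b'] -> a = a' /\ b = b'.
Proof.
move=> d1 d2.
(* If the last indices differ, the larger one can be moved to [d'.+1] while the other pair stays
   fixed, contradicting [dist_ab_ac]. The cases only list the possible orders of the other
   indices. *)
have lt_last c d c' d' : c < d -> c' < d' -> d < d' ->
    f [:: c; d] <> f [:: c'; d'].
  move=> cd cd' dd' e.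
  suff e' : f [:: c; d] = f [:: c'; d'.+1].
    case: (@dist_ab_ac [:: c'] [:: d'] [:: d'.+1] d1); last by rewrite /= -e.
    by rewrite /blocks /= cd' ltnSn.
  have [ltc|ltc|ec] := ltngtP c' c.
  - have := @hom [:: false; true; true; false] [:: true; false; false; true]
      [:: [:: c']; [:: c]; [:: d]; [:: d']] [:: [:: c']; [:: c]; [:: d]; [:: d'.+1]].
    by rewrite /=; apply=> //; rewrite /blocks /nonnil /=; lia.
  - have [ltd|ltd|ed] := ltngtP c' d.
    + have := @hom [:: true; false; true; false] [:: false; true; false; true]
        [:: [:: c]; [:: c']; [:: d]; [:: d']] [:: [:: c]; [:: c']; [:: d]; [:: d'.+1]].
      by rewrite /=; apply=> //; rewrite /blocks /nonnil /=; lia.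
    + have := @hom [:: true; true; false; false] [:: false; false; true; true]
        [:: [:: c]; [:: d]; [:: c']; [:: d']] [:: [:: c]; [:: d]; [:: c']; [:: d'.+1]].
      by rewrite /=; apply=> //; rewrite /blocks /nonnil /=; lia.
    + subst c'; have := @hom [:: true; true; false] [:: false; true; true]
        [:: [:: c]; [:: d]; [:: d']] [:: [:: c]; [:: d]; [:: d'.+1]].
      by rewrite /=; apply=> //; rewrite /blocks /nonnil /=; lia.
  - subst c'; have := @hom [:: true; true; false] [:: true; false; true]
      [:: [:: c]; [:: d]; [:: d']] [:: [:: c]; [:: d]; [:: d'.+1]].
    by rewrite /=; apply=> //; rewrite /blocks /nonnil /=; lia.
move=> ab ab' e.
have [bb|bb|bb] := ltngtP b b'.
- by case: (lt_last _ _ _ _ ab ab' bb).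
- by case: (lt_last _ _ _ _ ab' ab bb).
subst b'; split=> //; have [aa|aa|//] := ltngtP a a'.
- case: (@dist_ac_bc [:: a] [:: a'] [:: b] d2) => //.
  by rewrite /blocks /= aa ab'.
- case: (@dist_ac_bc [:: a'] [:: a] [:: b] d2) => //.
  by rewrite /blocks /= aa ab.
Qed.

(** Cutting at all entries of [u] and [v] turns both spreads into selections from the same at most
    [2 k] cells. Different selections of equal colour are excluded by [equal_patterns]. *)
Lemma spread_inj u v k : dist12 -> dist1 -> dist2 -> 2 * k <= n ->
  f [:: 0; 1; 2] <> f [:: 0; 2] -> index_seq k u -> index_seq k v ->
  f (spread u) = f (spread v) -> u = v.
Proof.
move=> d12 d1 d2 kn d3 [su eu u0 uk] [sv ev v0 vk] e.
pose e0 := sort leq (undup (u ++ v)).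
have se0 : sorted ltn e0.
  by rewrite ltn_sorted_uniq_leq sort_uniq undup_uniq (sort_sorted leq_total).
have sub w : sorted ltn w -> {subset w <= u ++ v} -> seq.filter (mem w) e0 = w.
  move=> sw wuv; apply: (irr_sorted_eq ltn_trans ltnn) => //.
    exact: sorted_filter ltn_trans _ _ se0.
  move=> i; rewrite mem_filter mem_sort mem_undup.
  by apply/andP/idP => [[]//|iw]; split=> //; exact: wuv.
have fu : seq.filter (mem u) e0 = u by apply: sub => // i; rewrite mem_cat => ->.
have fv : seq.filter (mem v) e0 = v.
  by apply: sub => // i; rewrite mem_cat orbC => ->.
have sz : size e0 <= n.
  rewrite size_sort; apply: leq_trans (size_undup _) _; rewrite size_cat.
  by apply: leq_trans (leq_add uk vk) _; lia.
case: e0 se0 fu fv sz {sub} => [|a e0] /= se0 fu fv sz; first by rewrite -fu -fv.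
have wordE w : ~~ odd (size w) ->
    (if mem w a then a :: seq.filter (mem w) e0 else seq.filter (mem w) e0) = w ->
    spread w = flatten (mask (word (mem w) (mem w a) e0) (cells a e0)).
  move=> ew fw; rewrite -[in LHS]fw spread_cells //.
  move: ew; rewrite -[in size w]fw; case: ifP => _ /=; rewrite size_filter.
    by rewrite negbK => ->.
  by move/negbTE->.
rewrite (wordE u eu fu) (wordE v ev fv) in e.
have [ww|/eqP ww] := eqVneq (word (mem u) (mem u a) e0) (word (mem v) (mem v a) e0).
  have [ea ee] := word_inj ww.
  by rewrite -[LHS]fu -[RHS]fv (eq_in_filter ee); move: ea => /= ->.
have [|A0 [B0 [b [R [AE BE sAB]]]]] := last_difference _ ww.
  by rewrite !size_word.
have szA : size (A0 ++ b :: R) = size (cells a e0) by rewrite -AE size_word size_cells.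
have szc : size (cells a e0) <= n by rewrite size_cells.
case: d3; have bl := blocks_cells se0; rewrite AE BE in e.
case: b szA e {AE BE} => szA e.
  exact: equal_patterns e.
apply: (@equal_patterns B0 A0 R (cells a e0)) => //.
by rewrite -szA !size_cat sAB.
Qed.

Let x (j : nat) : nat := block_sum z (iota 0 j.*2).

Lemma asum_spread u : sorted ltn u -> asum x u = block_sum z (spread u).
Proof.
elim/pair_ind: u => [_|a _|a b u IH /= /andP[ab pu]].
- by rewrite /block_sum big_nil.
- by rewrite /block_sum big_nil.
rewrite block_sum_cat IH ?(path_sorted pu) // /x; congr (_ + _).
have -> : b.*2 = a.*2 + (b - a).*2 by lia.
by rewrite iotaD block_sum_cat addKn add0n.
Qed.

Lemma canonical_kind k : 2 * k <= n -> exists c, canonical_coloring k D x c.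
Proof.
move=> kn.
have DE u : index_seq k u -> D (asum x u) = f (spread u).
  by move=> [su _ _ _]; rewrite asum_spread.
have ends u : index_seq k u -> exists2 l,
    spread u = (head 0 u).*2 :: rcons l (last 0 u).*2.-1 & sorted ltn (spread u).
  move=> [su eu u0 _]; have [l lE] := spread_ends su eu u0.
  by exists l => //; exact: sorted_spread.
have pos u : index_seq k u -> head 0 u < last 0 u.
  case: u => [|a [|b u]] [] // su _ _ _.
  have /allP := order_path_min ltn_trans su; apply; exact: mem_last.
have [c|d12] := pselect (f [:: 0] = f [:: 1]).
  exists Constant => u v iu iv; split=> // _; rewrite !DE //.
  have [lu -> su] := ends _ iu; have [lv -> sv] := ends _ iv.
  rewrite /= in su sv.
  (* A single index beyond both spreads, with which each of them is compared. *)
  pose m := maxn (last 0 u).*2 (last 0 v).*2.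
  rewrite (@ext12 _ [:: m] c) ?(@ext12 (_ :: rcons lv _) [:: m] c) //.
    rewrite /blocks /= cats1 rcons_path sv last_rcons !andbT /m.
    by have := pos _ iv; lia.
  rewrite /blocks /= cats1 rcons_path su last_rcons !andbT /m.
  by have := pos _ iu; lia.
have [c|d2] := pselect (f [:: 0; 1] = f [:: 1]).
  have fE u : index_seq k u -> D (asum x u) = f [:: (last 0 u).*2.-1].
    move=> iu; rewrite DE //; have [l lE su] := ends _ iu; rewrite lE.
    rewrite -rcons_cons -cats1 ext2 // /blocks /= cats1.
    by rewrite lE /= in su; rewrite su.
  exists ByMax => u v iu iv; rewrite !fE //=; split=> [|->//].
  (* By [pos] both last entries are positive, so the truncated predecessor loses no information. *)
  by move/(single_inj d12); have := pos _ iu; have := pos _ iv; lia.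
have [c|d1] := pselect (f [:: 0; 1] = f [:: 0]).
  have fE u : index_seq k u -> D (asum x u) = f [:: (head 0 u).*2].
    move=> iu; rewrite DE //; have [l lE su] := ends _ iu; rewrite lE.
    rewrite -cat1s ext1 // /blocks /= cats0 andbT /nonnil size_rcons.
    by rewrite lE /= in su; rewrite su.
  exists ByMin => u v iu iv; rewrite !fE //=; split=> [|->//].
  by move/(single_inj d12); lia.
have [c|d3] := pselect (f [:: 0; 1; 2] = f [:: 0; 2]); last first.
  exists Injective => u v iu iv; rewrite !DE //=; split=> [|->//].
  exact: spread_inj d12 d1 d2 kn d3 iu iv.
have fE u : index_seq k u -> D (asum x u) = f [:: (head 0 u).*2; (last 0 u).*2.-1].
  move=> iu; rewrite DE //; have [l lE su] := ends _ iu; rewrite lE.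
  case: l lE => [//|a l] lE; rewrite lE in su.
  rewrite -cat1s -cats1 ext_middle //.
  by rewrite /blocks /= in su *; rewrite cats1 su.
exists ByMinMax => u v iu iv; rewrite !fE //=.
have pu := pos _ iu; have pv := pos _ iv; split=> [|[-> ->]//].
by move/pair_inj => /(_ d1 d2); lia.
Qed.

End Canonical.

Theorem canonical_alternating_sums (k : nat) (D : nat -> nat) : 2 <= k ->
  exists x c, [/\ x 0 = 0, forall i j, i < j -> x i < x j & canonical_coloring k D x c].
Proof.
move=> k2; pose n := 2 * k.
pose Phi (i : n.-tuple bool * n.-tuple bool) (s : seq nat) :=
  D (sumn (mask i.1 s)) = D (sumn (mask i.2 s)).
have [z zpos zhom] := Milliken_Taylor Phi n.
have sumE (A : bitseq) ls : sumn (mask A (map (block_sum z) ls)) =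
    block_sum z (flatten (mask A ls)).
  rewrite -map_mask; elim: (mask A ls) => [|l ls' IH] /=.
    by rewrite /block_sum big_nil.
  by rewrite block_sum_cat IH.
have hom (A B : bitseq) ls ls' : size A = size ls ->
    size B = size ls -> size ls' = size ls -> size ls <= n ->
    blocks ls -> blocks ls' ->
    D (block_sum z (flatten (mask A ls))) = D (block_sum z (flatten (mask B ls))) ->
    D (block_sum z (flatten (mask A ls'))) = D (block_sum z (flatten (mask B ls'))).
  move=> sA sB sls lsn bl bl' e.
  (* The ramsey statement concerns exactly [n] blocks: shorter lists are padded by singletons beyond
     all indices in use, which the masks leave out. *)
  pose d := n - size ls.
  pose pad (X : bitseq) := X ++ nseq d false.
  have szpad X : size X = size ls -> size (pad X) == n.
    by move=> sX; rewrite size_cat size_nseq sX subnKC.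
  pose top := (\max_(i <- flatten ls ++ flatten ls') i).+1.
  pose tail := [seq [:: i] | i <- iota top d].
  have blt l : blocks l -> {subset flatten l <= flatten ls ++ flatten ls'} ->
      blocks (l ++ tail).
    move=> /andP[srt ne] sub; rewrite /blocks flatten_cat flatten_single all_cat ne.
    apply/andP; split; last by rewrite all_map; apply/allP.
    rewrite (sorted_pairwise ltn_trans) pairwise_cat -!(sorted_pairwise ltn_trans).
    rewrite srt iota_ltn_sorted !andbT; apply/allrelP => i j /sub il.
    by rewrite mem_iota => /andP[+ _]; apply: leq_trans; exact: leq_bigmax_seq.
  have maskE X l : size X = size l -> mask (pad X) (l ++ tail) = mask X l.
    by move=> sX; rewrite mask_cat // mask_false cats0.
  have := zhom (Tuple (szpad _ sA), Tuple (szpad _ sB)) (ls ++ tail) (ls' ++ tail).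
  rewrite /Phi /= !sumE !maskE ?sA ?sB //; apply=> //.
  - by apply: blt => // i; rewrite mem_cat => ->.
  - by apply: blt => // i; rewrite mem_cat orbC => ->.
  - by rewrite size_cat size_map size_iota subnKC.
  - by rewrite size_cat size_map size_iota sls subnKC.
have n4 : 4 <= n by rewrite /n; lia.
have [c cP] := canonical_kind n4 hom (leqnn n).
exists (fun j => block_sum z (iota 0 j.*2)), c; split=> //.
  by rewrite /block_sum big_nil.
move=> i j ij; have -> : j.*2 = i.*2 + (1 + ((j - i).*2.-1)) by lia.
by rewrite iotaD block_sum_cat /= block_sum_cons; have := zpos (0 + i.*2); lia.
Qed.

(** * Index sets as increasing sequences *)

Definition kseq (k : nat) (s : seq nat) : Prop :=
  [/\ sorted ltn s, size s = k & forall i, i \in s -> 0 < i].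

Lemma sorted_incr_seq J : sorted ltn (incr_seq J).
Proof.
by rewrite ltn_sorted_uniq_leq sort_uniq fset_uniq; exact: sort_sorted leq_total _.
Qed.

Lemma kseq_incr_seq k J : ksubsets k J -> kseq k (incr_seq J).
Proof.
move=> [Jpos Jk]; split; [exact: sorted_incr_seq|by rewrite size_sort|].
by move=> i; rewrite mem_sort => /Jpos.
Qed.

Lemma kseq_ksubset k s : kseq k s -> exists2 J, ksubsets k J & incr_seq J = s.
Proof.
move=> [ss sk pos]; pose J : {fset nat} := [fset i in s]%fset.
have e : incr_seq J = s.
  apply: (irr_sorted_eq ltn_trans ltnn) => //; first exact: sorted_incr_seq.
  by move=> i; rewrite mem_sort inE.
exists J => //; split; first by move=> i /=; rewrite inE => /pos.
by rewrite -sk -[in RHS]e size_sort.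
Qed.

Lemma incr_seq_inj I J : incr_seq I = incr_seq J -> I = J.
Proof.
move=> e; apply/fsetP => i.
by rewrite -(mem_sort leq (enum_fset I)) -(mem_sort leq (enum_fset J)) -/(incr_seq I) e.
Qed.

Lemma alt_sum_asum x J : alt_sum x J = asum x (incr_seq J).
Proof.
have -> : alt_sum x J = \sum_(i < (size (incr_seq J))./2)
    (x (nth 0 (incr_seq J) i.*2.+1) - x (nth 0 (incr_seq J) i.*2)).
  by rewrite /alt_sum size_sort.
elim/pair_ind: (incr_seq J) => [|a|a b u IH] /=; rewrite ?big_ord0 //.
by rewrite big_ord_recl /= -IH.
Qed.

Lemma Xalt_asum k x s : kseq k s -> Xalt k x (asum x s).
Proof. by move=> /kseq_ksubset[J kJ <-]; exists J => //; exact: alt_sum_asum. Qed.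

Lemma nat_infinite_set (A : set nat) :
  (forall n, exists2 m, A m & n < m) -> infinite_set A.
Proof.
move=> unb /finite_seqP[s sA].
have [m Am lt] := unb (\max_(i <- s) i).
have : m <= \max_(i <- s) i by apply: leq_bigmax_seq => //; rewrite sA in Am.
by rewrite leqNgt lt.
Qed.

Definition increasing (x : nat -> nat) : Prop :=
  (forall i j, 0 < i -> i < j -> x i < x j) /\ (forall i, 0 < i -> 0 < x i).

Lemma increasing_ge x j : increasing x -> j <= x j.
Proof.
move=> [xi xp]; elim: j => // -[|j] IH; first exact: xp.
by apply: leq_ltn_trans IH _; apply: xi.
Qed.

Lemma increasing_inj x i j : increasing x -> 0 < i -> 0 < j -> x i = x j -> i = j.
Proof.
move=> [xi _] i0 j0 e; have [ij|ij|//] := ltngtP i j.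
  by have := xi _ _ i0 ij; rewrite e ltnn.
by have := xi _ _ j0 ij; rewrite e ltnn.
Qed.

Lemma increasing_infinite_subset x : increasing x ->
  infinite_subset (x @` Npos) x.
Proof.
move=> ix; split=> //; last by split=> //; case: ix.
  by move=> _ [i i0 <-]; exact: ix.2.
apply: nat_infinite_set => n; exists (x n.+1); first by exists n.+1.
exact: increasing_ge.
Qed.

Lemma infinite_subset_increasing X x : infinite_subset X x ->
  increasing x /\ X = x @` Npos.
Proof.
move=> [Xpos _ [xi XE]]; split=> //; split=> // i i0.
by apply: Xpos; rewrite XE; exists i.
Qed.

(** Elements of [X] are sums with minimum 0 and those of [Xalt] have positive minimum; this gives
    the disjoint colour sets for the kinds that see the minimum. *)
Lemma canonical_pattern k D x c : 2 <= k -> ~~ odd k -> x 0 = 0 ->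
  canonical_coloring k D x c -> exists p, has_pattern k D (x @` Npos) x p.
Proof.
move=> k2 kev x0 can.
have xE j : x j = asum x [:: 0; j] by rewrite /= x0 subn0 addn0.
have ix j : 0 < j -> index_seq k [:: 0; j] by move=> j0; split=> //=; rewrite ?j0.
have iJ J : ksubsets k J -> index_seq k (incr_seq J).
  by move=> /kseq_incr_seq[sJ szJ _]; split; rewrite ?szJ ?(ltnW k2).
have min_pos J : ksubsets k J -> 0 < minJ J.
  move=> /kseq_incr_seq[_ sz pos]; apply: pos; rewrite /minJ.
  by case: (incr_seq J) sz => [|a s] sz; [rewrite -sz in k2|exact: mem_head].
have rep a : (x @` Npos `|` Xalt k x) a -> exists2 u, index_seq k u & a = asum x u.
  move=> [[j j0 <-]|[J kJ <-]]; first by exists [:: 0; j]; [exact: ix|].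
  by exists (incr_seq J); [exact: iJ|exact: alt_sum_asum].
case: c can => can.
- exists PatI => a b /rep[u iu ->] /rep[v iv ->].
  by apply/can.
- exists PatIV; split.
  + by move=> _ _ [i i0 <-] [j j0 <-]; rewrite !xE; apply/can => //; exact: ix.
  + apply/seteqP; split=> // _ [[_ [j j0 <-] <-]] [_ [J kJ <-]].
    rewrite alt_sum_asum xE => /can => /(_ (iJ _ kJ) (ix _ j0)) /= e.
    by have := min_pos _ kJ; rewrite /minJ e.
  + move=> I J kI kJ; rewrite !alt_sum_asum.
    by split=> [/can|e]; [move=> /(_ (iJ _ kJ) (iJ _ kI))|apply/can => //; exact: iJ].
- exists PatIII; split.
  + move=> _ _ [i i0 <-] [j j0 <-] ne; rewrite !xE.
    by move=> /can => /(_ (ix _ i0) (ix _ j0)) /= e; apply: ne; rewrite e.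
  + move=> J kJ; rewrite alt_sum_asum xE; apply/can => //; [exact: iJ|apply: ix].
    have [_ sz pos] := kseq_incr_seq kJ; apply: pos; rewrite /maxJ.
    by case: (incr_seq J) sz => [|a s] sz; [rewrite -sz in k2|exact: mem_last].
- exists PatV; split.
  + move=> _ _ [i i0 <-] [j j0 <-] ne; rewrite !xE.
    by move=> /can => /(_ (ix _ i0) (ix _ j0)) /= [_ e]; apply: ne; rewrite e.
  + apply/seteqP; split=> // _ [[_ [j j0 <-] <-]] [_ [J kJ <-]].
    rewrite alt_sum_asum xE => /can => /(_ (iJ _ kJ) (ix _ j0)) /= [e _].
    by have := min_pos _ kJ; rewrite /minJ e.
  + move=> I J kI kJ; rewrite !alt_sum_asum; split.
      by move=> /can => /(_ (iJ _ kJ) (iJ _ kI)) [].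
    by move=> [e e']; apply/can; [exact: iJ|exact: iJ|split].
- exists PatII => a b /rep[u iu ->] /rep[v iv ->] ne /can.
  by move=> /(_ iu iv) /= uv; apply: ne; rewrite uv.
Qed.

Lemma pattern_exists k D : 2 <= k -> ~~ odd k ->
  exists X x, infinite_subset X x /\ exists p, has_pattern k D X x p.
Proof.
move=> k2 kev; have [x [c [x0 xi can]]] := canonical_alternating_sums D k2.
exists (x @` Npos), x; split; last exact: canonical_pattern can.
apply: increasing_infinite_subset; split=> [i j _|i i0]; first exact: xi.
by rewrite -x0; exact: xi.
Qed.

(** * The patterns in terms of index sequences *)

Section Consequences.
Variables (k : nat) (D x : nat -> nat).
Let X := x @` Npos.

Lemma pattern3_asum s : has_pattern k D X x PatIII -> kseq k s ->
  D (asum x s) = D (x (last 0 s)).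
Proof.
by move=> [_ p] /kseq_ksubset[J kJ <-]; rewrite -alt_sum_asum; exact: p.
Qed.

Lemma pattern5_asum s t : has_pattern k D X x PatV -> kseq k s -> kseq k t ->
  D (asum x s) = D (asum x t) <-> head 0 s = head 0 t /\ last 0 s = last 0 t.
Proof.
move=> [_ _ p] /kseq_ksubset[J kJ <-] /kseq_ksubset[I kI <-].
rewrite -!alt_sum_asum; split; last by move=> [e1 e2]; apply/p.
by move=> /p => /(_ kI kJ)[].
Qed.

Lemma rainbow_asum s t : rainbow D (X `|` Xalt k x) -> kseq k s -> kseq k t ->
  D (asum x s) = D (asum x t) -> asum x s = asum x t.
Proof.
move=> rb ks kt e; apply: contrapT => ne.
by apply: (rb _ _ _ _ ne e); right; exact: Xalt_asum.
Qed.

Lemma monochromatic_asum s t : monochromatic D (X `|` Xalt k x) ->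
  kseq k s -> kseq k t -> D (asum x s) = D (asum x t).
Proof. by move=> mono ks kt; apply: mono; right; exact: Xalt_asum. Qed.

Lemma monochromaticU : monochromatic D (X `|` Xalt k x) -> monochromatic D X.
Proof. by move=> mono a b Xa Xb; apply: mono; left. Qed.

End Consequences.

Lemma kseq_iota k m : 0 < m -> kseq k (iota m k).
Proof.
move=> m0; split; [exact: iota_ltn_sorted|by rewrite size_iota|].
by move=> i; rewrite mem_iota => /andP[+ _]; exact: leq_trans.
Qed.

Lemma kseq_cons k a s : 0 < a -> (forall i, i \in s -> a < i) -> kseq k s ->
  kseq k.+1 (a :: s).
Proof.
move=> a0 lt [ss sz pos]; split=> [|/=|i].
- by rewrite /= path_min_sorted //; apply/allP.
- by rewrite sz.
- by rewrite inE => /orP[/eqP->//|/pos].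
Qed.

(** Regrouping leaves the last term minus the first term minus the positive gaps between consecutive
    pairs. *)
Lemma asum_le_last x s : increasing x -> kseq (size s) s -> ~~ odd (size s) ->
  0 < size s -> asum x s + x (head 0 s) <= x (last 0 s).
Proof.
move=> [xi xp]; elim/pair_ind: s => // a b u IH [/= /andP[ab pu] _ pos].
rewrite negbK => ev _; have a0 : 0 < a by apply: pos; rewrite mem_head.
have xab := xi _ _ a0 ab.
case: u IH pu pos ev => [|c u] IH pu pos ev; first by rewrite /=; lia.
have {}IH : asum x (c :: u) + x c <= x (last 0 (c :: u)).
  apply: IH => //; split=> //; first exact: path_sorted pu.
  by move=> i iu; apply: pos; rewrite !inE in iu *; rewrite iu !orbT.
have xbc : x b < x c by apply: xi; [lia|case/andP: pu].
have -> : last b (c :: u) = last 0 (c :: u) by [].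
lia.
Qed.

(** The last pair alone already contributes this much. *)
Lemma asum_ge x s N C : odd (size s) -> (forall a, a \in s -> x a <= C) ->
  x N - C <= asum x (rcons s N).
Proof.
elim/pair_ind: s => //= [a _ h|a b s IH].
  by have := h a (mem_head _ _); lia.
rewrite negbK => os h; apply: leq_trans (IH os _) (leq_addl _ _).
by move=> c cs; apply: h; rewrite !inE cs !orbT.
Qed.

(** * Colourings admitting a single pattern *)

Lemma infinite_pigeonhole (h : nat -> nat) m : (forall j, h j < m) ->
  exists r, forall n, exists2 j, n < j & h j = r.
Proof.
elim: m h => [|m IH] h hm; first by have := hm 0.
have [|nm] := pselect (forall n, exists2 j, n < j & h j = m); first by exists m.
have [n0 n0P] : exists n, forall j, n < j -> h j < m.
  apply: contrapT => no; apply: nm => n; apply: contrapT => nn.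
  apply: no; exists n => j nj; have := hm j; rewrite ltnS leq_eqVlt.
  by case/orP => // /eqP hj; case: nn; exists j.
have [r rP] := IH (fun j => h (n0.+1 + j)) (fun j => n0P _ (leq_addr _ _)).
exists r => n; have [j nj hj] := rP n; exists (n0.+1 + j) => //.
exact: leq_trans nj (leq_addl _ _).
Qed.

Lemma logn2_eqmod m n M : m = n %[mod 2 ^ M] -> ~~ (2 ^ M %| n) ->
  logn 2 m = logn 2 n /\ logn 2 n < M.
Proof.
move=> e nd.
have n0 : 0 < n by case: n e nd; rewrite ?dvdn0.
have ndm : ~~ (2 ^ M %| m) by rewrite /dvdn e.
have m0 : 0 < m by case: m {e} ndm; rewrite ?dvdn0.
have ltM a : 0 < a -> ~~ (2 ^ M %| a) -> logn 2 a < M.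
  by move=> a0; rewrite pfactor_dvdn // -ltnNge.
have le a b : a = b %[mod 2 ^ M] -> 0 < a -> 0 < b -> ~~ (2 ^ M %| a) ->
    logn 2 a <= logn 2 b.
  move=> ab a0 b0 nda; rewrite -pfactor_dvdn //.
  have d : 2 ^ logn 2 a %| 2 ^ M by rewrite dvdn_exp2l // ltnW // ltM.
  by rewrite /dvdn -(modn_dvdm _ d) -ab (modn_dvdm _ d) -/(dvdn _ _) pfactor_dvdnn.
by split; [apply/eqP; rewrite eqn_leq !le|exact: ltM].
Qed.

(** * Controlling the 2-adic valuation along a residue class *)

Section Valuation.
Variables (x : nat -> nat).
Hypothesis ix : increasing x.

(* Infinitely many [x j] agree modulo [2 ^ M], and since [2 ^ M > x 2 > x 1]
   one of [x 1], [x 2] is not in their residue class. *)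
Lemma residue_subsequence : exists M c d (g : nat -> nat),
  [/\ 0 < c, d < M, (forall i, c < g i) /\ (forall i j, i < j -> g i < g j),
      forall u, sorted ltn u -> ~~ odd (size u) ->
        2 ^ M %| asum x (map g u) &
      forall u, sorted ltn u -> odd (size u) ->
        logn 2 (asum x (c :: map g u)) = d].
Proof.
pose M := x 2.
have [r rP] := infinite_pigeonhole
  (fun j => ltn_pmod (x j) (expn_gt0 2 M : 0 < 2 ^ M)).
have /choice[next nextP] : forall n, exists j, n < j /\ x j %% 2 ^ M = r.
  by move=> n; have [j] := rP n; exists j.
(* Starting at 2 puts every [g i] above 2, hence above [c], which is 1 or 2. *)
pose g i := iter i.+1 next 2.
have gS i : g i < g i.+1 by have [] := nextP (g i).
have gi i j : i < j -> g i < g j by exact: (homo_ltn ltn_trans gS).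
have g2 i : 2 < g i.
  by case: i => [|i]; [have [] := nextP 2|apply: ltn_trans (gi 0 i.+1 isT); have [] := nextP 2].
have gr i : x (g i) %% 2 ^ M = r by have [] := nextP (iter i next 2).
have x12 : x 1 < x 2 by apply: ix.1.
have x2M : x 2 < 2 ^ M by exact: ltn_expl.
have [c [c0 c2 cr]] : exists c, [/\ 0 < c, c <= 2 & x c != r].
  have [e|ne] := eqVneq (x 1) r; last by exists 1.
  by exists 2; split=> //; rewrite -e; lia.
have cM : x c < 2 ^ M.
  by apply: leq_ltn_trans x2M; case: c c0 c2 {cr} => [|[|[|]]] // *; exact: ltnW.
have cg i : c < g i := leq_ltn_trans c2 (g2 i).
have xcg i : x c < x (g i) by apply: ix.1.
pose n0 := x (g 0) - x c.
have nd : ~~ (2 ^ M %| n0).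
  rewrite /n0 -eqn_mod_dvd; last exact: ltnW.
  by rewrite gr (modn_small cM) eq_sym.
have even u : sorted ltn u -> ~~ odd (size u) -> 2 ^ M %| asum x (map g u).
  elim/pair_ind: u => [|a|a b u IH] //= /andP[ab pu]; rewrite negbK => ou.
  rewrite dvdn_add ?IH ?(path_sorted pu) //.
  rewrite -eqn_mod_dvd ?gr //; apply: ltnW; apply: ix.1; last exact: gi.
  exact: leq_ltn_trans (g2 a).
exists M, c, (logn 2 n0), g; split=> //.
  by have [] := logn2_eqmod (erefl (n0 %% 2 ^ M)) nd.
case=> [//|a u] /= pu ou; apply: (proj1 (@logn2_eqmod _ _ M _ nd)).
have /eqP e := even u (path_sorted pu) ou.
(* Modulo [2 ^ M] the even tail vanishes and [x (g a) - x c] is congruent to [n0]. *)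
apply/eqP; rewrite -modnDmr e addn0 -(eqn_modDr (x c)) /n0.
by rewrite !subnK ?(ltnW (xcg _)) // !gr.
Qed.

End Valuation.

Lemma kseq_map (g : nat -> nat) k m : 0 < g 0 ->
  (forall i j, i < j -> g i < g j) -> kseq k (map g (iota m k)).
Proof.
move=> g0 gi; split; last 1 first.
- by move=> _ /mapP[[|i] _ ->] //; apply: leq_ltn_trans (gi 0 i.+1 isT).
- have := iota_ltn_sorted m k; apply: homo_sorted => i j; exact: gi.
- by rewrite size_map size_iota.
Qed.

Lemma asum_gt0 x k s : increasing x -> kseq k s -> 2 <= k -> 0 < asum x s.
Proof.
move=> [xi _]; case: s => [|a [|b s]] [] /=; try by move=> _ <-.
move=> /andP[ab _] _ pos _; have := xi a b (pos a (mem_head _ _)) ab; lia.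
Qed.

(** * Excluding the other patterns, colouring by colouring *)

Section NoOtherPattern.
Variables (k : nat) (D x : nat -> nat).
Hypothesis k_ge2 : 2 <= k.
Hypothesis k_even : ~~ odd k.
Hypothesis ix : increasing x.
Let X := x @` Npos.

Lemma X_x j : 0 < j -> X (x j).
Proof. by exists j. Qed.

Lemma same_color_12 : monochromatic D X -> D (x 1) = D (x 2).
Proof. by move=> mono; apply: mono; exact: X_x. Qed.

Lemma rainbow_color_12 : rainbow D X -> D (x 1) <> D (x 2).
Proof.
move=> rb; apply: rb; try exact: X_x.
by move=> /(@increasing_inj x 1 2 ix isT isT).
Qed.

Lemma no_pattern_constant q : (forall n, D n = 1) -> q <> PatI ->
  ~ has_pattern k D X x q.
Proof.
move=> D1; have e : D (x 1) = D (x 2) by rewrite !D1.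
case: q => // _.
- move=> rb; apply: rainbow_color_12 e => a b Xa Xb; apply: rb; exact: or_introl.
- by move=> [/rainbow_color_12].
- move=> [_ d _]; have : (D @` X `&` D @` Xalt k x) 1; last by rewrite d.
  split; first by exists (x 1); [exact: X_x|].
  by exists (asum x (iota 1 k)); [apply/Xalt_asum/kseq_iota|].
- by move=> [/rainbow_color_12].
Qed.

(** Pattern (iii) fails because a sum is smaller than its last term. Pattern (v) fails because
    changing the second index keeps both ends but changes the sum, which needs a third index. *)
Lemma no_pattern_injective q : (forall n, D n = n) ->
  q <> PatII -> (q = PatV -> 3 <= k) -> ~ has_pattern k D X x q.
Proof.
move=> Did; have ne : D (x 1) <> D (x 2).
  by rewrite !Did => /(@increasing_inj x 1 2 ix isT isT).
case: q => // _ k3.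
- by move=> /monochromaticU /same_color_12.
- move=> p; have ks : kseq k (iota 1 k) by exact: kseq_iota.
  have := pattern3_asum p ks; rewrite !Did => e.
  have := @asum_le_last x (iota 1 k) ix; rewrite size_iota e => /(_ ks k_even).
  have h1 : head 0 (iota 1 k) = 1 by case: (k) k_ge2.
  by move=> /(_ (ltnW k_ge2)); rewrite h1; have := ix.2 1 isT; lia.
- by move=> [/same_color_12].
- move=> p; have {}k3 := k3 erefl.
  have ks i : 1 < i < 4 -> kseq k [:: 1, i & iota 4 (k - 2)].
    move=> /andP[i1 i4]; rewrite -[in kseq _]((subnKC k_ge2)).
    apply: kseq_cons => // [j|]; last first.
      apply: kseq_cons; [exact: ltnW|move=> j|exact: kseq_iota].
      by rewrite mem_iota => /andP[j4 _]; lia.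
    by rewrite inE mem_iota => /orP[/eqP->//|/andP[j4 _]]; lia.
  have := pattern5_asum p (ks 2 isT) (ks 3 isT); rewrite !Did /=.
  have -> : k - 2 = (k - 3).+1 by lia.
  have x12 := ix.1 1 2 isT isT; have x23 := ix.1 2 3 isT isT.
  by move=> [_ /(_ (conj erefl erefl))]; lia.
Qed.

Section Log.
Hypothesis Dlog : forall a b, D a = D b -> trunc_log 2 a = trunc_log 2 b.

Lemma log_not_monochromatic : ~ monochromatic D X.
Proof.
(* Since [x N] is at least [N], its logarithm exceeds that of [x 1]. *)
move=> mono; pose N := 2 ^ (trunc_log 2 (x 1)).+1.
have N0 : 0 < N by rewrite expn_gt0.
have /Dlog e : D (x 1) = D (x N) by apply: mono; exact: X_x.
have := leq_trunc_log 2 (increasing_ge N ix).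
by rewrite -e trunc_expnK // ltnn.
Qed.

End Log.

(** Once the last term exceeds [2 C], each sum lies between half of it and all of it; the logarithm
    then takes at most two values on three sums. *)
Lemma log_collision (g : nat -> nat) s1 s2 s3 : (forall i, i <= g i) ->
  odd (size s1) -> odd (size s2) -> odd (size s3) ->
  exists2 m, forall a, a \in s1 ++ s2 ++ s3 -> a < m &
    let t s := trunc_log 2 (asum x (rcons s (g m))) in
    (forall i, i \in [:: s1; s2; s3] -> kseq k (rcons i (g m))) ->
    [\/ t s1 = t s2, t s1 = t s3 | t s2 = t s3].
Proof.
move=> gi o1 o2 o3; pose s := s1 ++ s2 ++ s3.
pose C := \max_(a <- s) x a; pose m := (C.*2 + \max_(a <- s) a).+1.
exists m => [a as_|t ks].
  by have : a <= \max_(a <- s) a; [exact: leq_bigmax_seq|rewrite /m; lia].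
have xm : C.*2 < x (g m).
  by apply: leq_trans (increasing_ge _ ix); apply: leq_trans (gi m); rewrite /m; lia.
have bnd i : i \in [:: s1; s2; s3] -> odd (size i) ->
    t i <= trunc_log 2 (x (g m)) <= (t i).+1.
  move=> is_ oi; have k0 : 0 < k := ltnW k_ge2; have [_ sz _] := ks i is_.
  have aC a : a \in i -> x a <= C.
    move=> ai; apply: leq_bigmax_seq => //; rewrite /s !mem_cat.
    by move: is_; rewrite !inE => /or3P[]/eqP<-; rewrite ai ?orbT.
  have lb := asum_ge (g m) oi aC.
  have ub := @asum_le_last x (rcons i (g m)) ix; rewrite sz last_rcons in ub.
  have {}ub := ub (ks i is_) k_even k0.
  move: lb ub; rewrite /t; set n := asum _ _; set h := x (head _ _) => lb ub.
  rewrite leq_trunc_log /=; last by lia.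
  rewrite -trunc_log2_double; last by lia.
  by apply: leq_trunc_log; lia.
have b1 := bnd s1 (mem_head _ _) o1.
have b2 : _ := bnd s2 _ o2; have {}b2 := b2 ltac:(by rewrite !inE eqxx orbT).
have b3 : _ := bnd s3 _ o3; have {}b3 := b3 ltac:(by rewrite !inE eqxx !orbT).
have [e|e12] := eqVneq (t s1) (t s2); first by constructor 1.
have [e|e13] := eqVneq (t s1) (t s3); first by constructor 2.
by constructor 3; lia.
Qed.

Lemma no_pattern_log q : (forall n, D n = (trunc_log 2 n).+1) ->
  q <> PatIII -> ~ has_pattern k D X x q.
Proof.
move=> DE; have Dlog a b : D a = D b -> trunc_log 2 a = trunc_log 2 b.
  by rewrite !DE => -[].
(* Three candidates that differ only in the first index 1, 2 or 3: two of them get the same colour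
   although their sums and minima differ. *)
pose s i := i :: iota 4 (k - 2).
have os i : odd (size (s i)) by rewrite /= size_iota oddB // addbF.
have [m lt col] := log_collision (fun i => leqnn i) (os 1) (os 2) (os 3).
have ks i : 0 < i < 4 -> kseq k (rcons (s i) m).
  move=> /andP[i0 i4].
  have sm j : j \in iota 4 (k - 2) -> j < m.
    by move=> ji; apply: lt; rewrite /s mem_cat inE ji orbT.
  have im : i < m by apply: lt; rewrite !mem_cat !inE; lia.
  split=> [||j]; rewrite ?rcons_cons.
  - rewrite /= rcons_path; apply/andP; split.
      rewrite path_min_sorted ?iota_ltn_sorted //; apply/allP => j.
      by rewrite mem_iota => /andP[j4 _]; exact: leq_trans j4.
    by have := mem_last i (iota 4 (k - 2)); rewrite inE => /orP[/eqP->|/sm].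
  - by rewrite /= size_rcons size_iota; lia.
  - rewrite inE mem_rcons inE mem_iota => /or3P[/eqP->|/eqP->|/andP[+ _]] //; lia.
have {}col : exists i j, [/\ 0 < i < 4, 0 < j < 4, i != j &
    D (asum x (rcons (s i) m)) = D (asum x (rcons (s j) m))].
  have [|e|e|e] := col.
  - by move=> u; rewrite !inE => /or3P[]/eqP->; exact: ks.
  - by exists 1, 2; split=> //; rewrite !DE e.
  - by exists 1, 3; split=> //; rewrite !DE e.
  - by exists 2, 3; split=> //; rewrite !DE e.
have [i [j [i4 j4 ij e]]] := col.
case: q => // _.
- by move=> /monochromaticU; exact: log_not_monochromatic.
- move=> rb; have := rainbow_asum rb (ks _ i4) (ks _ j4) e.
  have [b [w bw]] : exists b w, rcons (iota 4 (k - 2)) m = b :: w.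
    by case: (iota _ _) => [|b w]; [exists m, [::]|exists b, (rcons w m)].
  have sE a : rcons (s a) m = [:: a, b & w] by rewrite /s rcons_cons bw.
  rewrite !sE /=.
  have lt_b a : kseq k [:: a, b & w] -> x a < x b.
    by move=> [/= /andP[ab _] _ pos]; apply: ix.1 => //; apply: pos; exact: mem_head.
  have ib : x i < x b by apply: lt_b; rewrite -sE; exact: ks.
  have jb : x j < x b by apply: lt_b; rewrite -sE; exact: ks.
  move=> e'; have {}e' : x i = x j by lia.
  case/andP: i4 => i0 _; case/andP: j4 => j0 _.
  by move: ij; rewrite (increasing_inj ix i0 j0 e') eqxx.
- by move=> [/log_not_monochromatic].
- move=> p; have := pattern5_asum p (ks _ i4) (ks _ j4) => -[/(_ e)[/= ij' _] _].
  by rewrite ij' eqxx in ij.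
Qed.

Section Val.
Hypothesis Dval : forall a b, D a = D b -> logn 2 a = logn 2 b.

(** Two sums with the same last index, one inside the residue class and one starting at [c], have
    valuations at least [M] and below [M], whereas both patterns give them one colour. *)
Lemma valuation_not_pattern13 q : q = PatI \/ q = PatIII ->
  ~ has_pattern k D X x q.
Proof.
have [M [c [d [g [c0 dM [cg gi] even odd_]]]]] := residue_subsequence ix.
have g0 : 0 < g 0 := leq_ltn_trans (leq0n c) (cg 0).
have k1 : k = k.-1.+1 by lia.
have ks1 : kseq k (map g (iota 0 k)) by exact: kseq_map.
have ks2 : kseq k (c :: map g (iota 1 k.-1)).
  rewrite {1}k1; apply: kseq_cons => //; last exact: kseq_map.
  by move=> _ /mapP[i _ ->].
have v1 : M <= logn 2 (asum x (map g (iota 0 k))).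
  rewrite -pfactor_dvdn //; last exact: asum_gt0 ks1 _.
  by apply: even; [exact: iota_ltn_sorted|rewrite size_iota].
have v2 : logn 2 (asum x (c :: map g (iota 1 k.-1))) = d.
  apply: odd_; first exact: iota_ltn_sorted.
  by rewrite size_iota; lia.
suff e : has_pattern k D X x q -> q = PatI \/ q = PatIII ->
    D (asum x (map g (iota 0 k))) = D (asum x (c :: map g (iota 1 k.-1))).
  by move=> hq /e /(_ hq) /Dval; lia.
move=> p [qE|qE]; rewrite qE in p; first exact: monochromatic_asum p ks1 ks2.
rewrite (pattern3_asum p ks1) (pattern3_asum p ks2); congr (D (x _)).
have -> : k = k.-2.+2 by lia.
by [].
Qed.

End Val.

(** All sums starting at [c] share the valuation [d]; among them there are different sums, against
    (ii), and different maxima with the same minimum, against (v). *)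
Lemma no_pattern_valuation q : (forall n, D n = (logn 2 n).+1) ->
  q <> PatIV -> ~ has_pattern k D X x q.
Proof.
move=> DE; have Dval a b : D a = D b -> logn 2 a = logn 2 b by rewrite !DE => -[].
have [M [c [d [g [c0 dM [cg gi] even odd_]]]]] := residue_subsequence ix.
have g0 : 0 < g 0 := leq_ltn_trans (leq0n c) (cg 0).
have kc u : sorted ltn u -> size u = k.-1 -> kseq k (c :: map g u).
  move=> su sz; have -> : k = k.-1.+1 by lia.
  apply: kseq_cons => //; first by move=> _ /mapP[i _ ->].
  split; [|by rewrite size_map|by move=> _ /mapP[i _ ->]; exact: leq_ltn_trans (cg i)].
  by apply: homo_sorted su => i j; exact: gi.
have vd u v : sorted ltn u -> size u = k.-1 -> sorted ltn v -> size v = k.-1 ->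
    D (asum x (c :: map g u)) = D (asum x (c :: map g v)).
  by move=> su zu sv zv; rewrite !DE !odd_ ?zu ?zv //; lia.
case: q => // _.
- by apply: valuation_not_pattern13 => //; left.
- move=> rb; pose s i := i :: iota 2 (k - 2).
  have ss i : i < 2 -> sorted ltn (s i).
    move=> i2; rewrite /= path_min_sorted ?iota_ltn_sorted //; apply/allP => j.
    by rewrite mem_iota => /andP[+ _]; exact: leq_trans.
  have sz i : size (s i) = k.-1 by rewrite /= size_iota; lia.
  have := rainbow_asum rb (kc _ (ss 0 isT) (sz 0)) (kc _ (ss 1 isT) (sz 1)).
  move=> /(_ (vd _ _ (ss 0 isT) (sz 0) (ss 1 isT) (sz 1))) /=.
  have := ix.1 c (g 0) c0 (cg 0); have := ix.1 (g 0) (g 1) g0 (gi 0 1 isT); lia.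
- by apply: valuation_not_pattern13 => //; right.
- move=> p; have k1 : k.-1 = k.-2.+1 by lia.
  have s0 := iota_ltn_sorted 0 k.-1; have s1 := iota_ltn_sorted 1 k.-1.
  have z0 := size_iota 0 k.-1; have z1 := size_iota 1 k.-1.
  have := pattern5_asum p (kc _ s0 z0) (kc _ s1 z1) => -[/(_ (vd _ _ s0 z0 s1 z1))[_ +] _].
  have lastE a : last 0 (c :: map g (iota a k.-1)) = g (a + k.-2).
    by rewrite [in iota a _]k1 -[k.-2.+1]addn1 iotaD map_cat /= last_cat.
  by rewrite !lastE => e; have := gi (0 + k.-2) (1 + k.-2) (ltnSn _); rewrite e ltnn.
Qed.

(** Against (ii), the first index [c] fixes the valuation and a huge last term leaves two
    logarithms, while the second index takes three values giving different sums; four indices leave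
    room for this. *)
Lemma no_pattern_pair q : (forall n, D n = (choice.pickle (logn 2 n, trunc_log 2 n)).+1) ->
  4 <= k -> q <> PatV -> ~ has_pattern k D X x q.
Proof.
move=> DE k4.
have Dpair a b : D a = D b -> logn 2 a = logn 2 b /\ trunc_log 2 a = trunc_log 2 b.
  by rewrite !DE => -[] /(pcan_inj choice.pickleK) [].
have Dval a b : D a = D b -> logn 2 a = logn 2 b by move/Dpair=> [].
have Dlog a b : D a = D b -> trunc_log 2 a = trunc_log 2 b by move/Dpair=> [].
case: q => // _.
- by apply: valuation_not_pattern13 => //; left.
- move=> rb.
  have [M [c [d [g [c0 dM [cg gi] even odd_]]]]] := residue_subsequence ix.
  have g0 : 0 < g 0 := leq_ltn_trans (leq0n c) (cg 0).
  have gge i : i <= g i.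
    by elim: i => // i IH; apply: leq_ltn_trans IH (gi _ _ _).
  pose s i := c :: map g (i :: iota 3 (k - 3)).
  have os i : odd (size (s i)) by rewrite /= size_map size_iota; lia.
  have [m lt col] := log_collision gge (os 0) (os 1) (os 2).
  have sE i : rcons (s i) (g m) = c :: map g (i :: rcons (iota 3 (k - 3)) m).
    by rewrite /s rcons_cons -map_rcons.
  have sm j : j \in iota 3 (k - 3) -> j < m.
    move=> ji; apply: leq_ltn_trans (gge j) _; apply: lt.
    by rewrite mem_cat !inE; apply/orP; left; apply/or3P; apply: Or33; exact: map_f.
  have m3 : 3 < m by apply: sm; rewrite mem_iota; lia.
  have ss i : i < 3 -> sorted ltn (i :: rcons (iota 3 (k - 3)) m).
    move=> i3; rewrite /= rcons_path; apply/andP; split.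
      rewrite path_min_sorted ?iota_ltn_sorted //; apply/allP => j.
      by rewrite mem_iota => /andP[j3 _]; exact: leq_trans j3.
    have := mem_last i (iota 3 (k - 3)); rewrite inE => /orP[/eqP->|/sm //].
    exact: ltn_trans m3.
  have ks i : i < 3 -> kseq k (rcons (s i) (g m)).
    move=> i3; have k1 : k = k.-1.+1 by lia.
    rewrite sE [X in kseq X _]k1.
    apply: kseq_cons => //; first by move=> _ /mapP[j _ ->].
    split; [|by rewrite size_map /= size_rcons size_iota; lia|].
      by apply: homo_sorted (ss i i3) => a b; exact: gi.
    by move=> _ /mapP[j _ ->]; exact: leq_ltn_trans (cg j).
  have vs i : i < 3 -> logn 2 (asum x (rcons (s i) (g m))) = d.
    by move=> i3; rewrite sE odd_ ?ss //= size_rcons size_iota; lia.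
  have ne i j : i < j -> j < 3 ->
      trunc_log 2 (asum x (rcons (s i) (g m))) <>
      trunc_log 2 (asum x (rcons (s j) (g m))).
    move=> ij j3 e; have i3 := ltn_trans ij j3.
    have := rainbow_asum rb (ks i i3) (ks j j3); rewrite !DE !vs // e => /(_ erefl).
    rewrite !sE /=.
    have := ix.1 c (g i) c0 (cg i).
    have := ix.1 (g i) (g j) (leq_ltn_trans (leq0n c) (cg i)) (gi _ _ ij); lia.
  have [|e|e|e] := col.
  + by move=> u; rewrite !inE => /or3P[]/eqP->; exact: ks.
  + exact: ne e.
  + exact: ne e.
  + exact: ne e.
- by apply: valuation_not_pattern13 => //; right.
- by move=> [/log_not_monochromatic].
Qed.

End NoOtherPattern.

(** The successors keep the colours positive, and [pickle] codes a pair by one number. *)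
Definition extremal_coloring (p : pattern) (n : nat) : nat :=
  match p with
  | PatI => 1
  | PatII => n
  | PatIII => (trunc_log 2 n).+1
  | PatIV => (logn 2 n).+1
  | PatV => (choice.pickle (logn 2 n, trunc_log 2 n)).+1
  end.

Lemma extremal_coloringP p : coloring (extremal_coloring p).
Proof. by case: p => n. Qed.

Lemma no_other_pattern k p q X x : 2 <= k -> ~~ odd k -> infinite_subset X x ->
  q <> p -> (p = PatV \/ q = PatV -> 4 <= k) ->
  ~ has_pattern k (extremal_coloring p) X x q.
Proof.
move=> k2 kev /infinite_subset_increasing[ix ->] qp k4.
case: p qp k4 => qp k4.
- exact: no_pattern_constant.
- by apply: no_pattern_injective => // qV; apply: ltnW; apply: k4; right.
- exact: no_pattern_log.
- exact: no_pattern_valuation.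
- by apply: no_pattern_pair => //; apply: k4; left.
Qed.

(** * The case of two-element index sets *)

Lemma kseq2 s : kseq 2 s -> exists a b, [/\ s = [:: a; b], 0 < a & a < b].
Proof.
case: s => [|a [|b [|c s]]] [] //= /andP[ab _] _ pos.
by exists a, b; split=> //; apply: pos; exact: mem_head.
Qed.

(** A two-element index set is determined by its minimum and maximum, so (v) makes colours injective
    on index sets, while (ii) does so on numbers; [alt_generic] bridges the two. *)
Lemma pattern5_2 D X x :
  has_pattern 2 D X x PatV <-> has_pattern 2 D X x PatII /\ alt_generic 2 X x.
Proof.
split=> [[rb dis key]|[rb [gen dis]]].
- have dist a b : X a -> Xalt 2 x b -> D a <> D b.
    move=> Xa Xb e; have : (D @` X `&` D @` Xalt 2 x) (D a); last by rewrite dis.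
    by split; [exists a|exists b].
  have inj I J : ksubsets 2 I -> ksubsets 2 J ->
      D (alt_sum x I) = D (alt_sum x J) -> I = J.
    move=> kI kJ /(key _ _ kJ kI)[].
    rewrite /minJ /maxJ; have [a [b [sI _ _]]] := kseq2 (kseq_incr_seq kI).
    have [a' [b' [sJ _ _]]] := kseq2 (kseq_incr_seq kJ).
    by rewrite sI sJ /= => e1 e2; apply: incr_seq_inj; rewrite sI sJ e1 e2.
  split.
    move=> a b [Xa|[I kI <-]] [Xb|[J kJ <-]] ne.
    + exact: rb.
    + by apply: dist => //; exists J.
    + by move/esym; apply: dist => //; exists I.
    + by move/(inj _ _ kI kJ) => IJ; apply: ne; rewrite IJ.
  split; first by move=> I J kI kJ e; apply: inj => //; rewrite e.
  by apply/seteqP; split=> // a [Xa Xb]; case: (dist a a).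
- have eq a b : (X `|` Xalt 2 x) a -> (X `|` Xalt 2 x) b -> D a = D b -> a = b.
    by move=> Xa Xb e; apply: contrapT => ne; exact: (rb _ _ Xa Xb ne e).
  split.
  + by move=> a b Xa Xb; apply: rb; left.
  + apply/seteqP; split=> // _ [[a Xa <-]] [b Xb] e.
    have ab : b = a by apply: eq => //; [right|left].
    by have : (X `&` Xalt 2 x) a; [split=> //; rewrite -ab|rewrite dis].
  + move=> I J kI kJ; split=> [e|[e1 e2]].
      have <- : J = I; last by [].
      by apply: gen => //; apply: eq => //; right; [exists J|exists I].
    have [a [b [sI _ _]]] := kseq2 (kseq_incr_seq kI).
    have [a' [b' [sJ _ _]]] := kseq2 (kseq_incr_seq kJ).
    move: e1 e2; rewrite !alt_sum_asum /minJ /maxJ sI sJ /= => -> ->.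
    by [].
Qed.

(** Pattern (ii) passes to subsequences because differences of [y] are differences of [x]; rapid
    growth makes [y] generic, and [pattern5_2] applies. *)
Lemma pattern2_subsequence D X x : infinite_subset X x ->
  has_pattern 2 D X x PatII -> exists Y y,
    [/\ infinite_subset Y y, Y `<=` X & has_pattern 2 D Y y PatV].
Proof.
move=> /infinite_subset_increasing[ix ->] rb.
(* As [x i] is at least [i], this choice forces [y j.+1] above [3 * y j]. *)
pose g j := iter j (fun i => 3 * x i + 1) 1; pose y j := x (g j).
have g_pos j : 0 < g j by case: j => // j; rewrite /g iterS addn1.
have yS j : 3 * y j < y j.+1.
  by apply: leq_trans (increasing_ge _ ix); rewrite /g iterS addn1.
have y_lt i j : i < j -> 3 * y i < y j.
  elim: j => // j IH; rewrite ltnS leq_eqVlt => /orP[/eqP->//|/IH]; have := yS j; lia.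
have y_pos j : 0 < y j by exact: ix.2.
have iy : increasing y by split=> // i j _ /y_lt; lia.
have sub : y @` Npos `<=` x @` Npos by move=> _ [j _ <-]; exists (g j); [exact: g_pos|].
have g_lt i j : i < j -> g i < g j.
  move=> /y_lt lt; rewrite ltnNge leq_eqVlt; apply/negP => /orP[/eqP e|gji].
    by move: lt; rewrite /y e; lia.
  by have := ix.1 _ _ (g_pos j) gji; rewrite /y in lt; lia.
have alt J : ksubsets 2 J -> exists a b, [/\ incr_seq J = [:: a; b], 0 < a,
    a < b & alt_sum y J = y b - y a].
  move=> kJ; have [a [b [sJ a0 ab]]] := kseq2 (kseq_incr_seq kJ).
  by exists a, b; split=> //; rewrite alt_sum_asum sJ /= addn0.
exists (y @` Npos), y; split=> //; first exact: increasing_infinite_subset.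
apply/pattern5_2; split; last split.
- have subU : y @` Npos `|` Xalt 2 y `<=` x @` Npos `|` Xalt 2 x.
    move=> n [/sub|[J kJ <-]]; first by left.
    have [a [b [_ a0 ab ->]]] := alt J kJ; right.
    have := @Xalt_asum 2 x [:: g a; g b]; rewrite /= addn0; apply.
    split=> [/=|//|i]; first by rewrite g_lt.
    by rewrite !inE => /orP[]/eqP->.
  by move=> a b /subU Xa /subU Xb; exact: rb.
- move=> I J kI kJ.
  have [a [b [sI a0 ab ->]]] := alt I kI; have [c [d [sJ c0 cd ->]]] := alt J kJ.
  move=> e; apply: incr_seq_inj; rewrite sI sJ.
  have yab := y_lt _ _ ab; have ycd := y_lt _ _ cd.
  have bd : b = d.
    (* Each difference lies strictly between two thirds of its larger term and that term, so a
       larger maximum gives a larger difference. *)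
    by have [/y_lt|/y_lt|//] := ltngtP b d; have := y_pos a; have := y_pos c; lia.
  subst d; congr [:: _; _]; apply: (increasing_inj iy) => //; lia.
- apply/seteqP; split=> // _ [[i i0 <-]] [J kJ].
  have [a [b [_ a0 ab ->]]] := alt J kJ; have yab := y_lt _ _ ab; have ya := y_pos a.
  by have [/y_lt|/y_lt|->] := ltngtP i b; lia.
Qed.

Theorem theorem4p2 (k : nat) (k_ge2 : 2 <= k) (k_even : ~~ odd k) :
  (forall D : nat -> nat, coloring D ->
     exists (X : set nat) (x : nat -> nat), infinite_subset X x /\
       exists p : pattern, has_pattern k D X x p) /\
  (4 <= k ->
     forall p : pattern, exists D : nat -> nat, coloring D /\
       forall (X : set nat) (x : nat -> nat), infinite_subset X x ->
         forall q : pattern, q <> p -> ~ has_pattern k D X x q) /\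
  (k = 2 ->
     (forall (D : nat -> nat) (X : set nat) (x : nat -> nat),
        coloring D -> infinite_subset X x ->
        (has_pattern k D X x PatV <->
         has_pattern k D X x PatII /\ alt_generic k X x) /\
        (has_pattern k D X x PatII ->
         exists (Y : set nat) (y : nat -> nat),
           [/\ infinite_subset Y y, Y `<=` X & has_pattern k D Y y PatV])) /\
     (forall p : pattern, p <> PatV -> exists D : nat -> nat, coloring D /\
        forall (X : set nat) (x : nat -> nat), infinite_subset X x ->
          forall q : pattern, q <> PatV -> q <> p -> ~ has_pattern k D X x q)).
Proof.
split; [|split].
- by move=> D _; exact: pattern_exists.
- move=> k4 p; exists (extremal_coloring p); split.
    exact: extremal_coloringP.
  by move=> X x XX q qp; exact: no_other_pattern.
- move=> k2; subst k; split.
    move=> D X x _ XX; split; first exact: pattern5_2.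
    exact: pattern2_subsequence.
  move=> p pV; exists (extremal_coloring p); split.
    exact: extremal_coloringP.
  by move=> X x XX q qV qp; apply: no_other_pattern => // -[].
Qed.
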